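(* Assume that $X$ has the Vitali–Carathéodory property. (a) If $\mathcal P$ is proper (all closed balls are compact), then $C_X$ is an outer capacity. (b) If $\mathcal P$ is locally compact, then every weakly quasicontinuous function $u:\mathcal P\to[-\infty,\infty]$ is quasicontinuous.
   Context: Standing assumptions: $\mathcal P=(\mathcal P,d,\mu)$ is a metric space with a positive complete Borel measure $\mu$ such that $0<\mu(B)<\infty$ for every ball $B$; $\mu$ is extended as an outer measure to all subsets. A quasi-Banach function lattice $X=X(\mathcal P)$ is a vector space of extended real-valued measurable functions defined everywhere on $\mathcal P$ with a functional $\|\cdot\|_X$ such that: $X=\{u:\|u\|_X<\infty\}$; $\|u\|_X=0$ iff $u=0$ a.e., $\|au\|_X=|a|\|u\|_X$, and $\|u+v\|_X\le c_\wedge(\|u\|_X+\|v\|_X)$ for some constant $c_\wedge\ge1$; $|u|\le|v|$ a.e. implies $\|u\|_X\le\|v\|_X$; and if $u_n\ge0$ a.e. then $\|\sum_{n\ge1}u_n\|_X\le\sum_{n\ge1}c_\wedge^n\|u_n\|_X$. The quasinorm is assumed continuous: $\|u_n-u\|_X\to0$ implies $\|u_n\|_X\to\|u\|_X$. $X$ has the Vitali–Carathéodory property if for every measurable $u$, $\|u\|_X=\inf\{\|v\|_X: v\ge|u|,\ v \text{ lower semicontinuous on }\mathcal P\}$. A Borel $g:\mathcal P\to[0,\infty]$ is an upper gradient of $u:\mathcal P\to[-\infty,\infty]$ if $|u(\gamma(0))-u(\gamma(l_\gamma))|\le\int_\gamma g\,ds$ for every nonconstant rectifiable (arc-length parametrized)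 curve $\gamma:[0,l_\gamma]\to\mathcal P$. $N^1X(\mathcal P)=\{u\in X:\|u\|_{N^1X}:=\|u\|_X+\inf_g\|g\|_X<\infty\}$, infimum over upper gradients. $C_X(E)=\inf\{\|u\|_{N^1X}:u\in N^1X,\ u\ge1\text{ on }E\}$. $C_X$ is an outer capacity if $C_X(E)=\inf\{C_X(G):G\supset E\text{ open}\}$ for all $E\subset\mathcal P$. $u:\mathcal P\to[-\infty,\infty]$ is weakly quasicontinuous if for every $\varepsilon>0$ there is $E$ with $C_X(E)<\varepsilon$ and $u|_{\mathcal P\setminus E}$ (real-valued) continuous; quasicontinuous if $E$ can be chosen open. *)

(* Defs.v *)
From HB Require Import structures.
From mathcomp Require Import all_boot all_order all_algebra.
From mathcomp Require Import all_classical all_reals all_analysis.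
From mathcomp Require Import measurable_realfun.
Set Implicit Arguments. Unset Strict Implicit. Unset Printing Implicit Defensive.
Import Order.TTheory GRing.Theory Num.Theory.
Local Open Scope classical_set_scope.
Local Open Scope ring_scope.

Section Defs.
Context {R : realType} {d : measure_display} {T : measurableType d}.
Variable (dist : T -> T -> R).

Definition metric_axioms : Prop :=
  [/\ (forall x y, 0 <= dist x y), (forall x y, dist x y = 0 <-> x = y),
      (forall x y, dist x y = dist y x) &
      (forall x y z, dist x z <= dist x y + dist y z)].

Definition mball (x : T) (r : R) : set T := [set y | dist x y < r].
Definition mcball (x : T) (r : R) : set T := [set y | dist x y <= r].

Definition mopen (G : set T) : Prop :=
  forall x, G x -> exists2 r : R, 0 < r & mball x r `<=` G.

Definition mcompact (K : set T) : Prop :=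
  forall (I : Type) (U : I -> set T), (forall i, mopen (U i)) ->
    K `<=` \bigcup_i U i ->
    exists F : set I, finite_set F /\ K `<=` \bigcup_(i in F) U i.

Definition metric_proper : Prop := forall x (r : R), 0 < r -> mcompact (mcball x r).

Definition metric_locally_compact : Prop :=
  forall x, exists K, mcompact K /\ exists2 r : R, 0 < r & mball x r `<=` K.

Definition borel_set : set (set T) := <<s mopen >>.
Definition borel_fun (g : T -> \bar R) : Prop :=
  forall B : set (\bar R), measurable B -> borel_set (g @^-1` B).

Definition lsc (v : T -> \bar R) : Prop :=
  forall t : R, mopen [set x | (t%:E < v x)%E].

Definition standing_measure (mu : {measure set T -> \bar R}) : Prop :=
  [/\ (forall G, mopen G -> measurable G),
      measure_is_complete mu                    (* complete *) &
      (forall x (r : R), 0 < r -> (0 < mu (mball x r) < +oo)%E)].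

(* The functional ||.||_X is given on all measurable functions T -> \bar R,
   with values in [0, +oo]; X = { u measurable | ||u||_X < oo }. *)
Definition inX (nX : (T -> \bar R) -> \bar R) (u : T -> \bar R) : Prop :=
  measurable_fun setT u /\ (nX u < +oo)%E.

Definition qBFL (mu : {measure set T -> \bar R})
    (nX : (T -> \bar R) -> \bar R) (c : R) : Prop :=
  [/\ 1 <= c,
      (forall u, measurable_fun setT u -> (0 <= nX u)%E),
      (forall u, measurable_fun setT u ->
         (nX u = 0%E <-> {ae mu, forall x, u x = 0%E})),
      (forall u (a : R), measurable_fun setT u ->
         nX (fun x => (a%:E * u x)%E) = (`|a|%:E * nX u)%E) &
    [/\ (forall u v, measurable_fun setT u -> measurable_fun setT v ->
         (nX (fun x => u x + v x) <= c%:E * (nX u + nX v))%E),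
      (forall u v, measurable_fun setT u -> measurable_fun setT v ->
         {ae mu, forall x, (`|u x| <= `|v x|)%E} -> (nX u <= nX v)%E) &
      (forall us : nat -> T -> \bar R,
         (forall n, measurable_fun setT (us n)) ->
         (forall n x, (0 <= us n x)%E) ->
         (nX (fun x => \sum_(0 <= n <oo) us n x)
            <= \sum_(0 <= n <oo) ((c ^+ n.+1)%:E * nX (us n)))%E)]].

Definition continuous_qnorm (nX : (T -> \bar R) -> \bar R) : Prop :=
  forall (us : nat -> T -> \bar R) (u : T -> \bar R),
    (forall n, inX nX (us n)) -> inX nX u ->
    (fun n => nX (fun x => us n x - u x)%E) @ \oo --> 0%E ->
    (fun n => nX (us n)) @ \oo --> nX u.

Definition vitali_caratheodory (nX : (T -> \bar R) -> \bar R) : Prop :=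
  forall u, measurable_fun setT u ->
    nX u = ereal_inf [set nX v | v in
                       [set v | (forall x, `|u x| <= v x)%E /\ lsc v]].

Definition curve_length (gamma : R -> T) (s t : R) : \bar R :=
  ereal_sup [set z | exists (k : nat) (p : nat -> R),
     [/\ p 0%N = s, p k = t, (forall i, (i < k)%N -> p i <= p i.+1) &
         z = (\sum_(i < k) dist (gamma (p i)) (gamma (p i.+1)))%:E]].

(* a nonconstant rectifiable curve, parametrized by arc length on [0, l] *)
Definition arc_length_curve (gamma : R -> T) (l : R) : Prop :=
  0 < l /\ forall s t, 0 <= s -> s <= t -> t <= l ->
    curve_length gamma s t = (t - s)%:E.

Definition itv0 (l : R) : set R := `[0, l].

Definition line_integral (gamma : R -> T) (l : R) (g : T -> \bar R) : \bar R :=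
  (\int[lebesgue_measure]_(t in itv0 l) g (gamma t))%E.

Definition ug_diff (a b : \bar R) : \bar R :=
  if (a \is a fin_num) && (b \is a fin_num) then `|a - b|%E else +oo%E.

Definition upper_gradient (u g : T -> \bar R) : Prop :=
  [/\ borel_fun g, (forall x, (0 <= g x)%E) &
      forall gamma l, arc_length_curve gamma l ->
        (ug_diff (u (gamma 0%R)) (u (gamma l)) <= line_integral gamma l g)%E].

Variable nX : (T -> \bar R) -> \bar R.

Definition N1norm (u : T -> \bar R) : \bar R :=
  (nX u + ereal_inf [set nX g | g in [set g | upper_gradient u g]])%E.

Definition inN1X (u : T -> \bar R) : Prop :=
  inX nX u /\ (N1norm u < +oo)%E.

Definition capX (E : set T) : \bar R :=
  ereal_inf [set N1norm u | u in
     [set u | inN1X u /\ forall x, E x -> (1 <= u x)%E]].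

Definition outer_capacity : Prop :=
  forall E : set T,
    capX E = ereal_inf [set capX G | G in [set G | mopen G /\ E `<=` G]].

Definition cont_off (u : T -> \bar R) (E : set T) : Prop :=
  (forall x, ~ E x -> u x \is a fin_num) /\
  (forall x, ~ E x -> forall eps : R, 0 < eps -> exists2 delta : R, 0 < delta &
     forall y, ~ E y -> dist x y < delta -> `|fine (u y) - fine (u x)| < eps).

Definition weakly_quasicontinuous (u : T -> \bar R) : Prop :=
  forall eps : R, 0 < eps -> exists E, (capX E < eps%:E)%E /\ cont_off u E.

Definition quasicontinuous (u : T -> \bar R) : Prop :=
  forall eps : R, 0 < eps ->
    exists E, [/\ mopen E, (capX E < eps%:E)%E & cont_off u E].

End Defs.

(* Main.v *)
Require Import Defs.
From HB Require Import structures.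
From mathcomp Require Import all_boot all_order all_algebra finmap.
From mathcomp Require Import all_classical all_reals all_analysis.
From mathcomp Require Import measurable_realfun lra ring.

(** For nonnegative lower semicontinuous [w <= 1] and [rho], let [U x] be the infimum
    of [w (gamma l)] plus the integral of [rho] along [gamma], over all 1-Lipschitz
    curves [gamma] issued from [x].  Then [rho] is an upper gradient of [U], and if
    [rho >= A * w] with [A > 0], nearly optimal curves have bounded length, so that in a
    proper space Arzela-Ascoli and Fatou's lemma make [U] lower semicontinuous.

    (a) Given [u >= 1] on [E] with upper gradient [g], the Vitali-Caratheodory property
    yields lower semicontinuous [v >= |u|] and [rho >= g + v / n] of almost the same
    quasinorms, by continuity of the quasinorm.  With [w = min(v, 1)] one gets [U = 1] on
    [E], hence an open superset [{U > 1 / lambda}] of [E] of almost the same capacity.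

    (b) With [w] cut off outside [B(z, 2r)] and [rho >= g + v / r] the same construction
    needs only compactness near [z] and gives [U >= 1/2] on the part of [E] in [B(z, r)],
    at the price of a constant factor depending on [r].  As the measure makes the space
    separable, countably many such balls [B_k] cover it; quasicontinuity is local, so one
    takes exceptional sets [E_k] depending on the ball, of sufficiently small capacity,
    and the union of the open supersets of [E_k] in [B_k]. *)

Local Open Scope classical_set_scope.
Local Open Scope ring_scope.
Set Implicit Arguments. Unset Strict Implicit. Unset Printing Implicit Defensive.
Import Order.TTheory GRing.Theory Num.Theory.
Import numFieldNormedType.Exports.

(** * Lebesgue measure and integrals under 1-Lipschitz maps of the line *)

Section lebesgue_lipschitz.
Context {R : realType}.
Implicit Types (s : R -> R) (A B : set R).
Local Notation leb := (@lebesgue_measure R).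

(** An interval of midpoint [m k] and half-length [h k] is sent into the closed interval of the same
    half-length about [s (m k)], so a cover of [B] by half-open intervals yields a cover of [A] of
    no larger total length. Taking [A] inside the image spares the measurability of the image
    itself. *)
Lemma lebesgue_lipschitz_image s A B : (forall x y, `|s x - s y| <= `|x - y|) ->
  measurable A -> measurable B -> A `<=` s @` B -> (leb A <= leb B)%E.
Proof.
move=> sL mA mB AB.
rewrite /lebesgue_measure /lebesgue_stieltjes_measure /measure_extension [leRHS]/mu_ext.
apply: le_ereal_inf_tmp => _ [F [mF BF]] <-.
have {}mF k : exists ab : R * R, ab.1 < ab.2 /\ F k = `]ab.1, ab.2]%classic \/
    F k = set0.
  have /ocitvP[->|[x x12 ->]] := mF k; first by exists (0, 1); right.
  by exists x; left.
have /choice[ab Fab] := mF.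
pose m k := ((ab k).1 + (ab k).2) / 2.
pose h k := ((ab k).2 - (ab k).1) / 2.
pose G k := if F k == set0 then set0 else `[s (m k) - h k, s (m k) + h k]%classic.
have mG k : measurable (G k : set (measurableTypeR R)).
  by rewrite /G; case: ifPn => _; [exact: measurable0|exact: measurable_itv].
apply: (@le_trans _ _ (\sum_(0 <= k <oo) leb (G k))%E).
  apply: measure_sigma_subadditive => //.
  move=> y /AB[x /BF[k _ Fkx] <-]; exists k => //.
  rewrite /G; case: ifPn => [/eqP F0|F0]; first by move: Fkx; rewrite F0.
  move: Fkx; case: (Fab k) => [|->//] [ab12 ->] /=.
  rewrite !in_itv /= => /andP[x1 x2].
  have := sL x (m k); have : `|x - m k| <= h k.
    by rewrite ler_norml /m /h; apply/andP; split; lra.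
  by move=> H1 /le_trans/(_ H1); rewrite ler_norml => /andP[? ?]; lra.
apply: lee_nneseries => // k _.
rewrite /G; case: ifPn => [/eqP ->|F0]; first by rewrite measure0 wlength_ge0.
case: (Fab k) F0 => [[ab12 ->] _|->]; last by rewrite eqxx.
rewrite lebesgue_measure_itv /= wlength_itv /= !lte_fin ab12.
rewrite !EFinN -!EFinD /=; case: ifPn => _; rewrite lee_fin /h; lra.
Qed.

Lemma lipschitz_continuous s : (forall x y, `|s x - s y| <= `|x - y|) ->
  continuous s.
Proof.
move=> sL x; apply/(@cvgrPdist_le _ R) => e e0; near=> y.
apply: le_trans (sL _ _) _; near: y.
by apply: (cvgrPdist_le _ _).1 e e0; exact: cvg_id.
Unshelve. all: by end_near. Qed.

(** The measure inequality, applied to the parts of [A] and [B] lying over a measurable [C], says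
    that the pushforward by [s] of Lebesgue measure on [B] dominates Lebesgue measure on [A];
    integrals then compare. *)
Lemma integral_lipschitz_image s A B (f : R -> \bar R) :
  (forall x y, `|s x - s y| <= `|x - y|) ->
  measurable A -> measurable B -> A `<=` s @` B ->
  measurable_fun setT f -> (forall x, 0 <= f x)%E ->
  (\int[leb]_(x in A) f x <= \int[leb]_(x in B) f (s x))%E.
Proof.
move=> sL mA mB AB mf f0.
have ms : measurable_fun setT s
  by apply: continuous_measurable_fun; exact: lipschitz_continuous.
pose nA : {measure set (measurableTypeR R) -> \bar R} := mrestr leb mA.
pose nB : {measure set (measurableTypeR R) -> \bar R} := mrestr leb mB.
have eA : (\int[leb]_(x in A) f x = \int[nA]_(x in A) f x)%E.
  apply: eq_measure_integral => C mC CA.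
  by rewrite /nA /= /mrestr setIidl.
have eB : (\int[leb]_(x in B) f (s x) = \int[nB]_(x in B) f (s x))%E.
  apply: eq_measure_integral => C mC CA.
  by rewrite /nB /= /mrestr setIidl.
rewrite eA eB.
have mfs : measurable_fun setT (f \o s) by apply: measurableT_comp.
have -> : (\int[nB]_(x in B) f (s x) = \int[nB]_x f (s x))%E.
  rewrite [RHS](@ge0_negligible_integral _ _ _ nB setT (~` B)) //=; last first.
    by rewrite /mrestr setICl measure0.
  - exact: measurableC.
  - by rewrite setTD setCK.
have := @ge0_integral_pushforward _ _ (measurableTypeR R) (measurableTypeR R) R s ms nB setT f measurableT mf.
move=> /(_ (fun x _ => f0 x)); rewrite preimage_setT /= => <-.
apply: (@le_trans _ _ (\int[nA]_x f x)%E).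
  exact: ge0_subset_integral.
apply: ge0_le_measure_integral => // C mC.
rewrite /nA /= /mrestr /pushforward.
apply: (@lebesgue_lipschitz_image s) => //.
- exact: measurableI.
- by apply: measurableI => //; rewrite -[X in measurable X]setTI; exact: ms.
- by move=> y [Cy /AB[x Bx sxy]]; exists x => //; split => //=; rewrite /preimage /= sxy.
Qed.

End lebesgue_lipschitz.

(** * 1-Lipschitz curves, their length, and arc-length reparametrization *)

Section curves.
Context {R : realType} {d : measure_display} {T : measurableType d}.
Variable dist : T -> T -> R.
Hypothesis mdist : metric_axioms dist.
Implicit Types (gamma : R -> T) (s t l : R).

Let dist_ge0 x y : 0 <= dist x y. Proof. by case: mdist. Qed.
Let dist_eq0 x y : dist x y = 0 <-> x = y. Proof. by case: mdist. Qed.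
Let distC x y : dist x y = dist y x. Proof. by case: mdist. Qed.
Let dist_triangle y x z : dist x z <= dist x y + dist y z.
Proof. by case: mdist. Qed.
Let distxx x : dist x x = 0. Proof. exact/dist_eq0. Qed.

(** Curves live on the whole line although only an interval [[0, l]] matters; their compositions
    with Borel functions are then measurable everywhere. *)
Definition lip1 gamma := forall s t, dist (gamma s) (gamma t) <= `|s - t|.

(** For [0 <= l] this is the projection onto [[0, l]]; composing a curve with it freezes the curve
    outside that interval. *)
Definition clamp l t : R := Num.max 0 (Num.min t l).

Lemma clamp_ge0 l t : 0 <= clamp l t.
Proof. by rewrite /clamp le_max lexx. Qed.

Lemma clamp_le l t : 0 <= l -> clamp l t <= l.
Proof. by move=> l0; rewrite /clamp ge_max l0 ge_min lexx orbT. Qed.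

Lemma clamp_id l t : 0 <= t -> t <= l -> clamp l t = t.
Proof. by move=> t0 tl; rewrite /clamp (min_idPl tl) (max_idPr t0). Qed.

Lemma clamp_lip l s t : `|clamp l s - clamp l t| <= `|s - t|.
Proof.
have := ler_norm (s - t); have := ler_norm (t - s); rewrite (distrC t s) => h1 h2.
rewrite ler_norml /clamp !maxEle !minEle.
by case: (leP s l); case: (leP t l); (do ?case: ifPn); rewrite -?ltNge => *;
  apply/andP; split; lra.
Qed.

Lemma lip1_clamp gamma l : lip1 gamma -> lip1 (gamma \o clamp l).
Proof. by move=> gL s t /=; apply: le_trans (gL _ _) (clamp_lip _ _ _). Qed.

Lemma mopen_mball x r : mopen dist (mball dist x r).
Proof.
move=> y /= xy; exists (r - dist x y); first by rewrite subr_gt0.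
by move=> z /=; rewrite /mball /= => yz; have := dist_triangle y x z; lra.
Qed.

Lemma lip1_preimage_open gamma G : lip1 gamma -> mopen dist G ->
  open (gamma @^-1` G).
Proof.
move=> gL oG; rewrite openE => t /= /oG[r r0 rG].
apply/nbhs_ballP; exists r => //= s ts; apply: rG.
by apply: le_lt_trans (gL _ _) _; exact: ts.
Qed.

Lemma lip1_preimage_borel gamma G : lip1 gamma -> borel_set dist G ->
  measurable (gamma @^-1` G).
Proof.
move=> gL; move: G.
apply: (@smallest_sub _ _ _ [set G | measurable (gamma @^-1` G)]); last first.
  by move=> G /(lip1_preimage_open gL)/open_measurable.
split => /=.
- by rewrite preimage_set0; exact: measurable0.
- by move=> G mG; rewrite setTD preimage_setC; exact: measurableC.
- by move=> F mF; rewrite preimage_bigcup; exact: bigcup_measurable.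
Qed.

Lemma measurable_borel_lip1 gamma (g : T -> \bar R) : lip1 gamma ->
  borel_fun dist g -> measurable_fun setT (g \o gamma).
Proof.
move=> gL bg _ B mB; rewrite setTI comp_preimage.
by apply: lip1_preimage_borel => //; exact: bg.
Qed.

Lemma le_curve_length gamma s t : s <= t ->
  ((dist (gamma s) (gamma t))%:E <= curve_length dist gamma s t)%E.
Proof.
move=> st; apply: ereal_sup_ubound.
exists 1%N, (fun i => if i is 0%N then s else t); split => //.
- by case.
- by rewrite big_ord_recl big_ord0 /= addr0.
Qed.

Lemma curve_length_le gamma s t : lip1 gamma -> s <= t ->
  (curve_length dist gamma s t <= (t - s)%:E)%E.
Proof.
move=> gL st; apply: ge_ereal_sup => _ [k [p [ps pt pm ->]]].
rewrite lee_fin -ps -pt -(telescope_sumr p (leq0n k)) big_mkord.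
apply: ler_sum => i _; apply: le_trans (gL _ _) _.
by rewrite distrC ger0_norm // subr_ge0 pm.
Qed.

Lemma curve_lengthE gamma s t : lip1 gamma -> s <= t ->
  curve_length dist gamma s t = (fine (curve_length dist gamma s t))%:E.
Proof.
move=> gL st; rewrite fineK // fin_numE.
have := curve_length_le gL st; have := le_curve_length gamma st.
by case: curve_length.
Qed.

(** For one inequality, a partition is cut at [t] by taking minima and maxima with [t], and only the
    step across [t] uses the triangle inequality. For the other, partitions of the two pieces are
    concatenated. *)
Lemma curve_length_add gamma s t r : lip1 gamma -> s <= t -> t <= r ->
  curve_length dist gamma s r =
  (curve_length dist gamma s t + curve_length dist gamma t r)%E.
Proof.
move=> gL st tr; have sr := le_trans st tr.
apply/eqP; rewrite eq_le; apply/andP; split.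
  apply: ge_ereal_sup => _ [k [p [ps pr pm ->]]].
  pose p1 i := Num.min (p i) t; pose p2 i := Num.max (p i) t.
  apply: (@le_trans _ _ ((\sum_(i < k) dist (gamma (p1 i)) (gamma (p1 i.+1)))%:E +
    (\sum_(i < k) dist (gamma (p2 i)) (gamma (p2 i.+1)))%:E)%E).
    rewrite -EFinD lee_fin -big_split /=; apply: ler_sum => i _.
    have pi := pm i (ltn_ord i); rewrite /p1 /p2.
    case: (leP (p i) t) => h1; case: (leP (p i.+1) t) => h2;
      rewrite ?distxx ?addr0 ?add0r ?lexx//.
    by move: (lt_le_trans h1 pi); rewrite ltNge h2.
  apply: leeD; apply: ereal_sup_ubound; exists k.
  - exists p1; split => //; rewrite /p1 ?ps ?pr ?(min_idPl st) ?(min_idPr tr) //.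
    by move=> i ik; rewrite le_min2 // pm.
  - exists p2; split => //; rewrite /p2 ?ps ?pr ?(max_idPr st) ?(max_idPl tr) //.
    by move=> i ik; rewrite le_max2 // pm.
rewrite (curve_lengthE gL st) (curve_lengthE gL tr) (curve_lengthE gL sr).
rewrite -EFinD lee_fin; set x1 := fine _; set x2 := fine _; set x3 := fine _.
suff H k1 p1 k2 p2 : p1 0%N = s -> p1 k1 = t -> p2 0%N = t -> p2 k2 = r ->
    (forall i, (i < k1)%N -> p1 i <= p1 i.+1) ->
    (forall i, (i < k2)%N -> p2 i <= p2 i.+1) ->
    \sum_(i < k1) dist (gamma (p1 i)) (gamma (p1 i.+1)) +
    \sum_(i < k2) dist (gamma (p2 i)) (gamma (p2 i.+1)) <= x3.
  rewrite -lerBrDl -lee_fin -(curve_lengthE gL tr).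
  apply: ge_ereal_sup => _ [k2 [p2 [p2s p2r p2m ->]]].
  rewrite lee_fin lerBrDl -lerBrDr -lee_fin -(curve_lengthE gL st).
  apply: ge_ereal_sup => _ [k1 [p1 [p1s p1r p1m ->]]].
  by rewrite lee_fin lerBrDr H.
move=> p10 p1k p20 p2k p1m p2m.
rewrite -lee_fin -(curve_lengthE gL sr); apply: ereal_sup_ubound.
pose p i := if (i <= k1)%N then p1 i else p2 (i - k1)%N.
have pk1 i : p (k1 + i)%N = p2 i.
  rewrite /p; case: i => [|i]; first by rewrite addn0 leqnn p1k p20.
  by rewrite leqNgt addnS ltnS leq_addr /= -addnS addKn.
exists (k1 + k2)%N, p; split => //.
- by rewrite pk1.
- move=> i; case: (ltnP i k1) => [ik _|ki].
    by rewrite /p ik (ltnW ik) p1m.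
  by rewrite -(subnKC ki) ltn_add2l -addnS !pk1; exact: p2m.
- rewrite big_split_ord /=; congr (_ + _)%:E; apply: eq_bigr => i _ /=.
    by rewrite /p (ltn_ord i) (ltnW (ltn_ord i)).
  by rewrite -addnS !pk1.
Qed.

Lemma partition_itv (p : nat -> R) k : (forall i, (i < k)%N -> p i <= p i.+1) ->
  forall i, (i <= k)%N -> p 0%N <= p i /\ p i <= p k.
Proof.
move=> pm; have H i j : (i + j <= k)%N -> p i <= p (i + j)%N.
  elim: j => [|j ih]; first by rewrite addn0.
  by rewrite addnS => ijk; apply: le_trans (pm _ ijk); apply/ih/ltnW.
move=> i ik; split; first by rewrite -[i in leRHS]add0n H.
by rewrite -[in leRHS](subnKC ik) H // subnKC.
Qed.

(* The length function [sigma] of [gamma] is 1-Lipschitz and onto [[0, L]];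
   precomposing with a right inverse of it gives the arc-length parametrization,
   and [integral_lipschitz_image] bounds the line integral. *)
Lemma lip1_upper_gradient (u g : T -> \bar R) gamma l :
  upper_gradient dist u g -> lip1 gamma -> 0 <= l -> gamma 0 <> gamma l ->
  (ug_diff (u (gamma 0%R)) (u (gamma l)) <= line_integral gamma l g)%E.
Proof.
move=> [bg g0 ug] gL l0 gne.
pose len s t := fine (curve_length dist gamma s t).
pose sigma t := len 0 (Num.max 0 t).
have lenE s t : s <= t -> curve_length dist gamma s t = (len s t)%:E.
  exact: curve_lengthE.
have sigmaB s t : 0 <= s -> s <= t -> sigma t - sigma s = len s t.
  move=> s0 st; have t0 := le_trans s0 st.
  rewrite /sigma (max_idPr s0) (max_idPr t0).
  have := curve_length_add gL s0 st; rewrite !lenE // -EFinD => -[->].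
  by rewrite addrC addKr.
have len_bnd s t : s <= t -> dist (gamma s) (gamma t) <= len s t <= t - s.
  move=> st; rewrite -!lee_fin -lenE // le_curve_length // curve_length_le //.
have sigmam s t : 0 <= s -> s <= t -> sigma s <= sigma t.
  move=> s0 st; rewrite -subr_ge0 sigmaB //.
  by apply: le_trans (dist_ge0 _ _) _; case/andP: (len_bnd _ _ st) => h _; exact: h.
have sigma0 : sigma 0 = 0.
  rewrite /sigma maxxx; apply/eqP; have /andP[h1 h2] := len_bnd 0 0 (lexx _).
  by rewrite eq_le (le_trans (dist_ge0 _ _) h1) andbT (le_trans h2) // subrr.
have dist_sigma s t : 0 <= s -> 0 <= t ->
    dist (gamma s) (gamma t) <= `|sigma s - sigma t|.
  wlog st : s t / s <= t.
    move=> H s0 t0; case: (leP s t) => [st|/ltW ts]; first exact: H.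
    by rewrite distC distrC H.
  move=> s0 t0; rewrite distrC sigmaB //.
  by case/andP: (len_bnd _ _ st) => h _; rewrite (le_trans h) // ler_norm.
have sigmaL s t : `|sigma s - sigma t| <= `|s - t|.
  have sM x : sigma (Num.max 0 x) = sigma x by rewrite /sigma maxA maxxx.
  wlog st : s t / s <= t.
    move=> H; case: (leP s t) => [st|/ltW ts]; first exact: H.
    by rewrite distrC (distrC s) H.
  rewrite -(sM s) -(sM t) distrC (distrC s).
  have s0 : 0 <= Num.max 0 s by rewrite le_max lexx.
  have st' : Num.max 0 s <= Num.max 0 t by rewrite ge_max !le_max lexx st orbT.
  have /andP[_ h2] := len_bnd _ _ st'.
  rewrite ger0_norm ?subr_ge0 ?sigmam // sigmaB // (le_trans h2) //.
  rewrite (@ger0_norm _ (t - s)) ?subr_ge0 //.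
  by rewrite !maxEle; (do ?case: ifPn); rewrite -?ltNge => *; lra.
pose L := sigma l.
have L0 : 0 < L.
  rewrite lt_neqAle eq_sym -{2}sigma0 sigmam // andbT; apply/eqP => L0.
  have := dist_sigma 0 l (lexx _) l0; rewrite -/L L0 sigma0 subrr normr0.
  move=> h; apply: gne; apply/dist_eq0/eqP.
  by rewrite eq_le h dist_ge0.
have /choice[tau tauP] q : exists t, 0 <= q <= L -> [/\ 0 <= t, t <= l & sigma t = q].
  have [/andP[q0 qL]|nq] := boolP (0 <= q <= L); last by exists 0.
  have [] := @IVT R sigma 0 l q l0.
  - by apply: continuous_subspaceT; exact: lipschitz_continuous.
  - by rewrite sigma0 ge_min le_max q0 qL orbT.
  - by move=> t; rewrite in_itv /= => /andP[t0 tl] st; exists t.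
have cL q : 0 <= clamp L q <= L by rewrite clamp_ge0 clamp_le // ltW.
pose eta q := gamma (tau (clamp L q)).
have etaL : lip1 eta.
  move=> a b; apply: le_trans (clamp_lip L a b).
  have [a0 _ sa] := tauP _ (cL a); have [b0 _ sb] := tauP _ (cL b).
  by have := dist_sigma _ _ a0 b0; rewrite sa sb.
(* The curve does not move between two parameters with the same value of [sigma], so [gamma] factors
   through [sigma] whichever right inverse was chosen. *)
have etaE t : 0 <= t -> t <= l -> eta (sigma t) = gamma t.
  move=> t0 tl; apply/dist_eq0/eqP; rewrite eq_le dist_ge0 andbT.
  have [a0 _ sa] := tauP _ (cL (sigma t)).
  apply: le_trans (dist_sigma _ _ a0 t0) _; rewrite sa clamp_id ?subrr ?normr0 //.
    by rewrite -sigma0 sigmam.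
  exact: sigmam.
have eta_arc : arc_length_curve dist eta L.
  split => // s t s0 st tL.
  have s0L : 0 <= s <= L by rewrite s0 (le_trans st).
  have t0L : 0 <= t <= L by rewrite tL (le_trans s0).
  have [a0 al sa] := tauP _ s0L; have [b0 bl tb] := tauP _ t0L.
  have taum x y : 0 <= x -> x <= y -> y <= L -> tau x <= tau y.
    move=> x0; rewrite le_eqVlt => /predU1P[->//|xy yL].
    have x0L : 0 <= x <= L by rewrite x0 (le_trans (ltW xy)).
    have y0L : 0 <= y <= L by rewrite yL (le_trans x0 (ltW xy)).
    have [a1 _ sx] := tauP _ x0L; have [b1 _ sy] := tauP _ y0L.
    rewrite leNgt; apply/negP => yx; have := sigmam (tau y) (tau x) b1 (ltW yx).
    by rewrite sx sy leNgt xy.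
  have -> : (t - s)%:E = curve_length dist gamma (tau s) (tau t).
    by rewrite lenE ?taum // -sigmaB ?taum // sa tb.
  (* Partitions of [[s, t]] and of [[tau s, tau t]] are carried to each other by [tau] and [sigma],
     with equal polygonal sums. *)
  apply/eqP; rewrite eq_le; apply/andP; split.
    apply: ge_ereal_sup => _ [k [p [ps pt pm ->]]]; apply: ereal_sup_ubound.
    have pst i : (i <= k)%N -> s <= p i <= t.
      by move=> ik; have [] := partition_itv pm ik; rewrite ps pt => -> ->.
    exists k, (tau \o p); split; rewrite /= ?ps ?pt //.
    - move=> i ik; have /andP[? ?] := pst _ (ltnW ik); have /andP[? ?] := pst _ ik.
      by rewrite taum ?pm //; lra.
    - congr (_%:E); apply: eq_bigr => i _; rewrite /eta.
      have /andP[? ?] := pst _ (ltnW (ltn_ord i)).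
      have /andP[? ?] := pst _ (ltn_ord i).
      by rewrite !clamp_id //; lra.
  apply: ge_ereal_sup => _ [k [p [ps pt pm ->]]]; apply: ereal_sup_ubound.
  have pst i : (i <= k)%N -> tau s <= p i <= tau t.
    by move=> ik; have [] := partition_itv pm ik; rewrite ps pt => -> ->.
  exists k, (sigma \o p); split; rewrite /= ?ps ?pt //.
  - move=> i ik; have /andP[? ?] := pst _ (ltnW ik).
    by rewrite sigmam ?pm //; lra.
  - congr (_%:E); apply: eq_bigr => i _.
    have /andP[? ?] := pst _ (ltnW (ltn_ord i)).
    have /andP[? ?] := pst _ (ltn_ord i).
    by rewrite !etaE //; lra.
have := ug _ _ eta_arc.
have -> : eta 0 = gamma 0 by rewrite -[in LHS]sigma0 etaE.
rewrite {1}/L etaE // => /le_trans; apply.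
rewrite /line_integral /itv0.
apply: le_trans (@integral_lipschitz_image _ sigma _ `[0, l]%classic (g \o eta) sigmaL _ _ _ _ _) _.
- exact: measurable_itv.
- exact: measurable_itv.
- move=> q /=; rewrite in_itv /= => /tauP[t0 tl <-]; exists (tau q) => //=.
  by rewrite in_itv /= t0 tl.
- exact: measurable_borel_lip1.
- by move=> x /=.
rewrite le_eqVlt; apply/orP; left; apply/eqP; apply: eq_integral => t.
by rewrite inE /= in_itv /= => /andP[t0 tl]; rewrite etaE.
Qed.

End curves.

(** * Measurability of lower semicontinuous functions *)

Section lsc_measurable.
Context {R : realType} {d : measure_display} {T : measurableType d}.
Variable dist : T -> T -> R.
Implicit Types f : T -> \bar R.

Lemma measurable_fun_superlevel d' (S : measurableType d') (f : S -> \bar R) :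
  (forall r : R, measurable [set x | (r%:E < f x)%E]) -> measurable_fun setT f.
Proof.
move=> mf; apply: (measurability _ (ErealGenOInfty.measurableE R)).
move=> /= _ [_ [a ->]] <-; apply: measurableI => //.
by rewrite preimage_itvoy; exact: mf.
Qed.

Lemma lsc_borel f : lsc dist f -> borel_fun dist f.
Proof.
move=> lf B mB.
(* Being Borel is measurability for the sigma-algebra generated by the open sets, which here
   replaces the given one on [T]. *)
have : measurable_fun [set: g_sigma_algebraType (mopen dist)] f.
  by apply: measurable_fun_superlevel => r; apply: sub_sigma_algebra; exact: lf.
by move=> /(_ measurableT B mB); rewrite setTI.
Qed.

Hypothesis measurable_mopen : forall G, mopen dist G -> measurable G.

Lemma borel_measurable f : borel_fun dist f -> measurable_fun setT f.
Proof.
move=> bf _ B mB; rewrite setTI; have := bf _ mB; move: (f @^-1` B).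
apply: smallest_sub => //; split => //.
- by move=> A mA; rewrite setTD; exact: measurableC.
- by move=> A mA; exact: bigcup_measurable.
Qed.

Lemma lsc_measurable f : lsc dist f -> measurable_fun setT f.
Proof. by move=> /lsc_borel/borel_measurable. Qed.

End lsc_measurable.

Lemma eq_lee {R : realType} (x y : \bar R) : x = y -> (x <= y)%E.
Proof. by move=> ->. Qed.

Lemma normr_rev {R : realType} (l s t : R) : `|l - s - (l - t)| = `|s - t|.
Proof. by rewrite distrC; congr `|_|; ring. Qed.

Lemma integral_itvD {R : realType} (f : R -> \bar R) (l m : R) :
  measurable_fun setT f -> (forall x, 0 <= f x)%E -> 0 <= l -> 0 <= m ->
  (\int[lebesgue_measure]_(x in `[0%R, (l + m)%R]) f x =
   \int[lebesgue_measure]_(x in `[0%R, l]) f x +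
   \int[lebesgue_measure]_(x in `]l, (l + m)%R]) f x)%E.
Proof.
move=> mf f0 l0 m0.
have -> : `[0, l + m]%classic = `[0, l]%classic `|` `]l, l + m]%classic.
  apply/seteqP; split => t /=; rewrite !in_itv /=.
    by move=> /andP[-> ->]; case: (leP t l) => _; [left|right].
  by case=> /andP[h1 h2]; apply/andP; split; lra.
apply: ge0_integral_setU => //.
- exact: measurable_funS mf.
- by apply/disj_setPS => t /= []; rewrite !in_itv /= => /andP[_ h] /andP[h' _]; lra.
Qed.

(** * The infimum of path costs and its upper gradient *)

Section path_infimum.
Context {R : realType} {d : measure_display} {T : measurableType d}.
Variable dist : T -> T -> R.
Hypothesis mdist : metric_axioms dist.
Variables w rho : T -> \bar R.
Implicit Types (gamma : R -> T) (s t l : R).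

Let distC x y : dist x y = dist y x. Proof. by case: mdist. Qed.
Let dist_triangle y x z : dist x z <= dist x y + dist y z.
Proof. by case: mdist. Qed.

Definition path_cost gamma l : \bar R := (w (gamma l) + line_integral gamma l rho)%E.

(** Competitors are merely 1-Lipschitz, with a free final time, so that concatenations, truncations
    and limits of competitors are again competitors. *)
Definition path_inf (x : T) : \bar R :=
  ereal_inf [set z | exists gamma l,
    [/\ lip1 dist gamma, 0 <= l, gamma 0 = x & z = path_cost gamma l]].

Hypotheses (w0 : forall x, (0 <= w x)%E) (w1 : forall x, (w x <= 1)%E).
Hypotheses (rho0 : forall x, (0 <= rho x)%E) (brho : borel_fun dist rho).

Let w_fin x : w x \is a fin_num.
Proof. by rewrite ge0_fin_numE // (le_lt_trans (w1 x)) // ltry. Qed.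

Lemma line_integral_ge0 gamma l : (0 <= line_integral gamma l rho)%E.
Proof. exact: integral_ge0. Qed.

Lemma le_line_integral gamma l m : lip1 dist gamma -> l <= m ->
  (line_integral gamma l rho <= line_integral gamma m rho)%E.
Proof.
move=> gL lm; apply: ge0_subset_integral => //; rewrite /itv0.
- exact: measurable_itv.
- exact: measurable_itv.
- apply: measurable_funS (measurable_borel_lip1 gL brho) => //.
- by move=> t /=; rewrite !in_itv /= => /andP[-> /le_trans]; exact.
Qed.

Lemma path_inf_ge0 x : (0 <= path_inf x)%E.
Proof.
apply: le_ereal_inf_tmp => _ [gamma [l [_ _ _ ->]]].
by rewrite adde_ge0 // line_integral_ge0.
Qed.

Lemma path_inf_le x : (path_inf x <= w x)%E.
Proof.
apply: ge_ereal_inf; exists (path_cost (cst x) 0).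
  exists (cst x), 0; split => //.
  by move=> s t /=; case: mdist => _ /(_ x x)[_ ->].
by rewrite /path_cost /line_integral /itv0 set_itv1 integral_set1 adde0.
Qed.

Lemma path_inf_le1 x : (path_inf x <= 1)%E.
Proof. exact: le_trans (path_inf_le x) (w1 x). Qed.

Lemma path_inf_fin x : path_inf x \is a fin_num.
Proof. by rewrite ge0_fin_numE ?path_inf_ge0 // (le_lt_trans (path_inf_le1 x)) // ltry. Qed.

(** Following [gamma] up to time [l] and then a nearly optimal curve [eta] issued from [gamma l]
    gives a competitor [kappa] for the starting point. *)
Lemma path_inf_step gamma l : lip1 dist gamma -> 0 <= l ->
  (path_inf (gamma 0%R) <= line_integral gamma l rho + path_inf (gamma l))%E.
Proof.
move=> gL l0; apply/lee_addgt0Pr => e e0; rewrite -addeA.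
have [_ [eta [m [eL m0 e0g ->]]] cost_lt] :=
  lb_ereal_inf_adherent e0 (path_inf_fin (gamma l)).
apply: le_trans (leeD (lexx _) (ltW cost_lt)).
pose kappa t := if t <= l then gamma t else eta (t - l).
have kE t : 0 <= t -> kappa (l + t) = eta t.
  move=> t0; rewrite /kappa; case: ifPn => [h|_]; last by rewrite addrC addKr.
  have -> : t = 0 by lra.
  by rewrite addr0.
have kL : lip1 dist kappa.
  move=> s t; wlog st : s t / s <= t.
    move=> H; case: (leP s t) => [st|/ltW ts]; first exact: H.
    by rewrite distC distrC H.
  rewrite /kappa; case: (leP s l) => sl; case: (leP t l) => tl.
  - exact: gL.
  - apply: le_trans (dist_triangle (gamma l) _ _) _; rewrite -{2}e0g.
    apply: le_trans (lerD (gL _ _) (eL _ _)) _.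
    rewrite !ler0_norm; lra.
  - lra.
  - by apply: le_trans (eL _ _) _; rewrite opprB addrA subrK.
have mk : measurable_fun setT (rho \o kappa) by exact: measurable_borel_lip1.
apply: (@le_trans _ _ (path_cost kappa (l + m))).
  apply: ereal_inf_lbound; exists kappa, (l + m); split => //.
  - by rewrite addr_ge0.
  - by rewrite /kappa l0.
rewrite /path_cost kE // [leRHS]addeCA; apply: leeD => //.
rewrite /line_integral /itv0.
apply: le_trans (eq_lee (integral_itvD mk (fun t => rho0 _) l0 m0)) _.
apply: leeD.
  apply/eq_lee/eq_integral => t.
  by rewrite inE /= in_itv /= => /andP[t0 tl]; rewrite /kappa tl.
apply: le_trans (@integral_lipschitz_image _ (fun t => l + t) _ `[0, m]%classic
  (rho \o kappa) _ _ _ _ mk _) _ => //.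
- by move=> x y; rewrite opprD addrACA subrr add0r.
- move=> t /=; rewrite in_itv /= => /andP[h1 h2]; exists (t - l); last by rewrite addrC subrK.
  by rewrite /= in_itv /=; apply/andP; split; lra.
- by move=> x /=.
apply/eq_lee/eq_integral => t.
by rewrite inE /= in_itv /= => /andP[t0 tl]; rewrite kE.
Qed.

Lemma line_integral_rev gamma l : lip1 dist gamma ->
  (line_integral (fun t => gamma (l - t)%R) l rho <= line_integral gamma l rho)%E.
Proof.
move=> gL.
have gL' : lip1 dist (fun t => gamma (l - t)).
  by move=> s t; apply: le_trans (gL _ _) _; rewrite normr_rev.
apply: le_trans (@integral_lipschitz_image _ (fun t => l - t) _ (itv0 l)
  (rho \o (fun t => gamma (l - t))) _ _ _ _ _ _) _ => //.
- by move=> x y; rewrite normr_rev.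
- exact: measurable_itv.
- exact: measurable_itv.
- move=> t; rewrite /itv0 /= in_itv /= => /andP[h1 h2]; exists (l - t); last by rewrite subKr.
  by rewrite /itv0 /= in_itv /=; apply/andP; split; lra.
- exact: measurable_borel_lip1.
- by move=> x /=.
apply/eq_lee/eq_integral => t _ /=.
by rewrite subKr.
Qed.

Lemma arc_length_curve_lip1 gamma l : arc_length_curve dist gamma l ->
  lip1 dist (gamma \o clamp l).
Proof.
move=> [l0 gE].
have H s t : 0 <= s -> s <= t -> t <= l -> dist (gamma s) (gamma t) <= t - s.
  by move=> s0 st tl; rewrite -lee_fin -gE // le_curve_length.
move=> s t /=; apply: le_trans (clamp_lip l s t).
have := clamp_le s (ltW l0); have := clamp_le t (ltW l0).
have := clamp_ge0 l s; have := clamp_ge0 l t.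
move: (clamp l s) (clamp l t) => {}s {}t t0 s0 tl sl.
case: (leP s t) => [st|/ltW ts]; first by rewrite distrC ger0_norm ?subr_ge0 // H.
by rewrite distC ger0_norm ?subr_ge0 // H.
Qed.

(** The concatenation inequality, used for the curve and for its reversal, bounds the difference of
    the endpoint values from both sides. *)
Lemma path_inf_upper_gradient : upper_gradient dist path_inf rho.
Proof.
split => // gamma l arc; have [l0 _] := arc.
have gL := arc_length_curve_lip1 arc.
rewrite /ug_diff !path_inf_fin /=.
have -> : line_integral gamma l rho = line_integral (gamma \o clamp l) l rho.
  apply: eq_integral => t; rewrite inE /itv0 /= in_itv /= => /andP[t0 tl].
  by rewrite clamp_id.
have := path_inf_step gL (ltW l0).
have gL' : lip1 dist (fun t => (gamma \o clamp l) (l - t)).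
  by move=> s t; apply: le_trans (gL _ _) _; rewrite normr_rev.
have := path_inf_step gL' (ltW l0).
rewrite /= subr0 subrr !clamp_id ?lexx ?(ltW l0) //.
have := line_integral_rev l gL; rewrite /=.
have := line_integral_ge0 (gamma \o clamp l) l.
have /fineK <- := path_inf_fin (gamma 0); have /fineK <- := path_inf_fin (gamma l).
move: (fine _) (fine _) => a b.
case: (line_integral _ _ _) => [i||] //= _.
- case: (line_integral _ _ _) => [j||] //=.
  rewrite -!EFinD !lee_fin => ji h1 h2; rewrite ler_norml; apply/andP; split; lra.
- by move=> *; rewrite leey.
Qed.

End path_infimum.

(** * Lower limits of extended real sequences *)

Section limn_einf_bounds.
Context {R : realType}.
Implicit Types (u : (\bar R)^nat) (a : \bar R).

Lemma limn_einf_ge u a N : (forall n, (N <= n)%N -> (a <= u n)%E) ->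
  (a <= limn_einf u)%E.
Proof.
move=> au; rewrite limn_einf_lim; apply: lime_ge; first exact: is_cvg_einfs.
exists N => // n /= Nn; apply: le_ereal_inf_tmp => _ [m /= nm <-].
by apply: au; exact: leq_trans nm.
Qed.

Lemma limn_einf_le u a N : (forall n, (N <= n)%N -> (u n <= a)%E) ->
  (limn_einf u <= a)%E.
Proof.
move=> ua; rewrite limn_einf_lim; apply: lime_le; first exact: is_cvg_einfs.
apply: nearW => n; apply: ge_ereal_inf; exists (u (maxn n N)).
  by exists (maxn n N) => //=; exact: leq_maxl.
by apply: ua; exact: leq_maxr.
Qed.

Lemma measurable_fun_limn_einf d (S : measurableType d) (D : set S)
    (f : (S -> \bar R)^nat) : (forall n, measurable_fun D (f n)) ->
  measurable_fun D (fun x => limn_einf (f ^~ x)).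
Proof.
move=> mf.
have -> : (fun x => limn_einf (f ^~ x)) =
    (fun x => - limn_esup (fun n => - f n x))%E.
  apply/funext => x; rewrite -limn_einfN; congr limn_einf.
  by apply/funext => n /=; rewrite oppeK.
apply: measurableT_comp => //; apply: measurable_fun_limn_esup => n.
exact: measurableT_comp.
Qed.

End limn_einf_bounds.

(** * Arzela-Ascoli for 1-Lipschitz curves *)

Section curve_compactness.
Context {R : realType} {d : measure_display} {T : measurableType d}.
Variable dist : T -> T -> R.
Hypothesis mdist : metric_axioms dist.

Let distC x y : dist x y = dist y x. Proof. by case: mdist. Qed.
Let distxx x : dist x x = 0. Proof. by case: mdist => _ h _ _; exact/h. Qed.
Let dist_triangle y x z : dist x z <= dist x y + dist y z.
Proof. by case: mdist. Qed.

(** Otherwise every point has a ball whose index set is outside [F]. Finitely many of these balls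
    cover [K], and the complements of their index sets, which belong to [F], would have a common
    element. *)
Lemma mcompact_ultra (K : set T) (F : set_system nat) (x_ : nat -> T) :
  UltraFilter F -> mcompact dist K -> (forall n, K (x_ n)) ->
  exists x, forall r : R, 0 < r -> F [set n | dist x (x_ n) < r].
Proof.
move=> FU cK Kx; apply: contrapT => nx.
have /choice[r rP] x : exists r : R, 0 < r /\ ~ F [set n | dist x (x_ n) < r].
  apply: contrapT => nr; apply: nx; exists x => r r0; apply: contrapT => nF.
  by apply: nr; exists r.
have [||D [/finite_fsetP[X ->]] KD] := cK T (fun x => mball dist x (r x)).
- by move=> x; exact: mopen_mball.
- move=> x _; exists x => //; rewrite /mball /= distxx; exact: (rP x).1.
have : F (\bigcap_(x in [set` X]) ~` [set n | dist x (x_ n) < r x]).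
  apply: filter_bigI => x _; have [h|//] := in_ultra_setVsetC [set n | dist x (x_ n) < r x] FU.
  by case: (rP x).2.
move=> /filter_ex[n nX]; have [x Xx xn] := KD _ (Kx n).
exact: nX Xx xn.
Qed.

(** A single ultrafilter refining the filter at infinity gives limits at all times at once, with no
    diagonal extraction; the Lipschitz bound makes the convergence uniform on [[0, L]]. *)
Lemma lip1_compact (K : set T) (gam : nat -> R -> T) (len : nat -> R) (L : R) :
  mcompact dist K -> (forall n, lip1 dist (gam n)) ->
  (forall n t, K (gam n t)) -> (forall n, 0 <= len n <= L) ->
  exists gamma l, [/\ lip1 dist gamma, 0 <= l <= L &
    forall (e : R) N, 0 < e -> exists n, [/\ (N <= n)%N, `|len n - l| < e &
      forall t, 0 <= t <= L -> dist (gamma t) (gam n t) < e]].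
Proof.
move=> cK gL gK lenL.
have [F [FU ooF]] := @ultraFilterLemma nat \oo _.
have FIF (A B : set nat) : F A -> F B -> F (A `&` B).
  by move=> FA FB; exact: filterI.
have FI (A B : set nat) : F A -> F B -> exists n, A n /\ B n.
  by move=> FA FB; have /filter_ex[n] := FIF _ _ FA FB; exists n.
have /choice[gamma gammaP] t : exists x, forall r : R, 0 < r -> F [set n | dist x (gam n t) < r].
  by apply: (mcompact_ultra FU cK) => n; exact: gK.
have [l [lL lenl]] : exists l : R, 0 <= l <= L /\ forall r : R, 0 < r -> F [set n | `|len n - l| < r].
  have [|l [/= + cl]] := @segment_compact R 0 L (len @ F) _.
    by apply: (@filterE _ F) => n /=; rewrite in_itv /=.
  rewrite in_itv /= => lL; exists l; split => // r r0.
  have [//|nF] := in_ultra_setVsetC [set n | `|len n - l| < r] FU.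
  have [|x [/= nx xl]] := cl (~` [set x | `|x - l| < r]) (ball l r) nF.
    exact: nbhsx_ballx.
  by exfalso; apply: nx; rewrite distrC.
have gammaL : lip1 dist gamma.
  move=> s t; apply/ler_addgt0Pr => e e0.
  have e2 : 0 < e / 2 by rewrite divr_gt0.
  have [n [/= h1 h2]] := FI _ _ (gammaP s _ e2) (gammaP t _ e2).
  have := dist_triangle (gam n s) (gamma s) (gamma t).
  have := dist_triangle (gam n t) (gam n s) (gamma t).
  have := gL n s t; rewrite (distC (gam n t) (gamma t)); lra.
exists gamma, l; split => // e N e0.
have e3 : 0 < e / 3 by rewrite divr_gt0.
(* A grid of mesh [e / 3] on [[0, L]]: a time and the grid point below it differ by less than
   [e / 3], which is lost once for each curve, and the last third is the error at the grid point. *)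
pose m := (Num.truncn (L / (e / 3))).+1.
have Fm : F (\bigcap_(i in `I_m) [set n | dist (gamma (i%:R * (e / 3))) (gam n (i%:R * (e / 3))) < e / 3]).
  have /finite_fsetP[X XE] := finite_II m.
  by rewrite XE; apply: filter_bigI => i _; exact: gammaP.
have Fml := FIF _ _ Fm (lenl _ e0).
have := FI _ _ Fml (ooF [set n | (N <= n)%N] (nbhs_infty_ge N)).
move=> [n [[/= gn ln] Nn]]; exists n; split => // t /andP[t0 tL].
have tq0 : 0 <= t / (e / 3) by rewrite divr_ge0 // ltW.
have /andP[i1 i2] := truncn_itv tq0.
set i := Num.truncn _ in i1 i2.
have im : (i < m)%N.
  rewrite -(ltr_nat R); apply: le_lt_trans i1 _.
  apply: le_lt_trans (truncnS_gt (L / (e / 3))).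
  by rewrite ler_pM2r // invr_gt0.
have /= := gn i im; rewrite ler_pdivlMr // in i1; rewrite ltr_pdivrMr // in i2.
set a := i%:R * (e / 3) in i1 *.
have i2' : t < a + e / 3 by move: i2; rewrite -natr1 mulrDl mul1r.
have : dist (gamma t) (gamma a) <= t - a.
  by rewrite -(@ger0_norm _ (t - a)) ?subr_ge0 //; exact: gammaL.
have := dist_triangle (gamma a) (gamma t) (gam n t).
have := dist_triangle (gam n a) (gamma a) (gam n t).
have := gL n a t; rewrite distrC ger0_norm ?subr_ge0 //; lra.
Qed.

End curve_compactness.

(** * Lower semicontinuity of the path infimum *)

Section path_infimum_lsc.
Context {R : realType} {d : measure_display} {T : measurableType d}.
Variable dist : T -> T -> R.
Hypothesis mdist : metric_axioms dist.
Variables w rho : T -> \bar R.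
Implicit Types (gamma : R -> T) (s t l : R).

Let distC x y : dist x y = dist y x. Proof. by case: mdist. Qed.
Let dist_ge0 x y : 0 <= dist x y. Proof. by case: mdist. Qed.
Let dist_triangle y x z : dist x z <= dist x y + dist y z.
Proof. by case: mdist. Qed.

Hypotheses (w0 : forall x, (0 <= w x)%E) (w1 : forall x, (w x <= 1)%E).
Hypotheses (rho0 : forall x, (0 <= rho x)%E).
Hypotheses (lw : lsc dist w) (lrho : lsc dist rho).
Variable A : R.
Hypotheses (A0 : 0 < A) (Aw : forall x, (A%:E * w x <= rho x)%E).

Let brho : borel_fun dist rho. Proof. exact: lsc_borel. Qed.

Local Notation cost := (path_cost w rho).

Let w_fin x : w x \is a fin_num.
Proof. by rewrite ge0_fin_numE // (le_lt_trans (w1 x)) // ltry. Qed.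

(* Since [rho >= A * w], a curve that is long and cheap passes through a point
   where [w] is small, and may be stopped there. *)
Lemma path_cost_truncate gamma l C L : lip1 dist gamma -> 0 <= l -> 0 < L ->
  (cost gamma l < C%:E)%E ->
  exists l', [/\ 0 <= l', l' <= l, l' <= L &
    (cost gamma l' <= (C + C / (A * L))%:E)%E].
Proof.
move=> gL l0 L0 costC.
have C0 : 0 < C.
  by rewrite -lte_fin (le_lt_trans _ costC) // adde_ge0 // line_integral_ge0.
have CA0 : 0 < C / (A * L) by rewrite divr_gt0 // mulr_gt0.
have [lL|Ll] := leP l L.
  by exists l; split => //; rewrite (le_trans (ltW costC)) // lee_fin; lra.
have IC : (line_integral gamma l rho < C%:E)%E.
  by apply: le_lt_trans costC; rewrite leeDr.
suff [s /andP[s0 sL] ws] : exists2 s, 0 <= s <= L & (w (gamma s) <= (C / (A * L))%:E)%E.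
  exists s; split => //; first by rewrite (le_trans sL) // ltW.
  rewrite addrC EFinD; apply: leeD => //.
  by apply: le_trans (ltW IC); apply: (le_line_integral rho0 brho gL); lra.
apply: contrapT => nw.
have h s : 0 <= s <= L -> ((C / L)%:E <= rho (gamma s))%E.
  move=> sL; apply: le_trans (Aw _).
  have /ltW : ((C / (A * L))%:E < w (gamma s))%E.
    by rewrite ltNge; apply/negP => ?; apply: nw; exists s.
  have /fineK <- := w_fin (gamma s); rewrite -EFinM !lee_fin => /(ler_wpM2l (ltW A0)).
  apply: le_trans; rewrite le_eqVlt; apply/orP; left; apply/eqP; field.
  by rewrite !gt_eqF.
have : (C%:E <= line_integral gamma L rho)%E.
  have -> : C%:E = (\int[lebesgue_measure]_(x in itv0 L) (C / L)%:E)%E.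
    rewrite integral_cst /=; last exact: measurable_itv.
    rewrite /itv0 lebesgue_measure_itv /= lte_fin L0 oppr0 adde0 -EFinM.
    by rewrite divfK // gt_eqF.
  apply: ge0_le_integral => //.
  - exact: measurable_itv.
  - by move=> x _; rewrite lee_fin divr_ge0 // ltW.
  - by apply: measurable_funS (measurable_borel_lip1 gL brho).
rewrite leNgt (le_lt_trans _ IC) //.
exact: (le_line_integral rho0 brho gL (ltW Ll)).
Qed.

Lemma lsc_cvg (f : T -> \bar R) (x_ : nat -> T) x (a : R) : lsc dist f ->
  (forall e : R, 0 < e -> exists N, forall n, (N <= n)%N -> dist x (x_ n) < e) ->
  (a%:E < f x)%E -> exists N, forall n, (N <= n)%N -> (a%:E < f (x_ n))%E.
Proof.
move=> lf xx_ /lf[r r0 rf]; have [N NP] := xx_ r r0.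
by exists N => n /NP/rf.
Qed.

(** Lower semicontinuity of [rho] along the curves and Fatou's lemma control the integral, and lower
    semicontinuity of [w] controls the final value. *)
Lemma path_cost_lim gamma l (gam : nat -> R -> T) (len : nat -> R) L C :
  lip1 dist gamma -> 0 <= l <= L -> (forall n, lip1 dist (gam n)) ->
  (forall n t, 0 <= t <= L -> dist (gamma t) (gam n t) < n.+1%:R^-1) ->
  (forall n, `|len n - l| < n.+1%:R^-1) ->
  (forall n, (cost (gam n) (len n) <= C%:E)%E) ->
  (cost gamma l <= C%:E)%E.
Proof.
move=> gL /andP[l0 lL] gnL gcv lcv costC.
have inv_small (e : R) : 0 < e -> exists N, forall n, (N <= n)%N -> n.+1%:R^-1 < e :> R.
  move=> e0; have [N _ NP] := near_infty_natSinv_lt (PosNum e0).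
  by exists N => n /NP.
(* The endpoint is left out because [len n] may be smaller than [l], whereas each [t < l] is
   eventually below [len n]. *)
pose D := `[0, l[%classic : set R.
pose f n := (rho \o gam n) \_ (itv0 (len n)).
have mf n : measurable_fun setT (f n).
  apply/(measurable_restrictT _ (measurable_itv _)).
  exact: measurable_funS (measurable_borel_lip1 (gnL n) brho).
have f0 n x : (0 <= f n x)%E by rewrite /f /patch /=; case: ifP => _ /=.
have fI n : (\int[lebesgue_measure]_(x in D) f n x <= line_integral (gam n) (len n) rho)%E.
  rewrite /line_integral [leRHS]integral_mkcond.
  by apply: ge0_subset_integral => //; [exact: measurable_itv|exact: mf].
have rho_lim t : D t -> (rho (gamma t) <= limn_einf (f ^~ t))%E.
  rewrite /D /= in_itv /= => /andP[t0 tl].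
  have H a : (a%:E < rho (gamma t))%E -> (a%:E <= limn_einf (f ^~ t))%E.
    move=> arho.
    have [|N1 N1P] := @lsc_cvg rho (fun n => gam n t) (gamma t) a lrho _ arho.
      move=> e /inv_small[N NP]; exists N => n /NP; apply: lt_trans.
      by apply: gcv; rewrite t0 /= (le_trans (ltW tl)).
    have [|N2 N2P] := inv_small (l - t); first by rewrite subr_gt0.
    apply: (@limn_einf_ge _ _ _ (maxn N1 N2)) => n; rewrite geq_max => /andP[n1 n2].
    rewrite /f /patch ifT; first exact/ltW/N1P.
    rewrite inE /itv0 /= in_itv /= t0 /=.
    have := lcv n; have := N2P n n2; move: (n.+1%:R^-1) => q.
    by rewrite ltr_norml => ? /andP[? ?]; lra.
  have : (0 <= rho (gamma t))%E by [].
  case E : (rho (gamma t)) => [r| |] // _.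
    apply/lee_addgt0Pr => e e0; rewrite -leeBlDr // -EFinB; apply: H.
    by rewrite E lte_fin; lra.
  rewrite leye_eq; apply/eqP/eqyP => a _; apply: H; rewrite E; exact: ltry.
(* Eventually the final values exceed [a], which leaves at most [C - a] for the integrals;
   afterwards [a] increases to [w (gamma l)]. *)
have H a : (a%:E < w (gamma l))%E ->
    (line_integral gamma l rho <= (C - a)%:E)%E.
  move=> aw.
  have [|N NP] := @lsc_cvg w (fun n => gam n (len n)) (gamma l) a lw _ aw.
    move=> e e0; have [|N NP] := inv_small (e / 2); first by rewrite divr_gt0.
    exists N => n /NP ne.
    have := dist_triangle (gam n l) (gamma l) (gam n (len n)).
    have := gnL n l (len n); rewrite distrC; have := lcv n.
    have : dist (gamma l) (gam n l) < n.+1%:R^-1 by apply: gcv; rewrite l0.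
    by move: ne; move: (n.+1%:R^-1) => q; lra.
  have -> : line_integral gamma l rho = (\int[lebesgue_measure]_(x in D) rho (gamma x))%E.
    apply/esym/integral_itv_bndo_bndc.
    exact: measurable_funS (measurable_borel_lip1 gL brho).
  have mD : measurable (D : set (measurableTypeR R)) by exact: measurable_itv.
  have mfD n : measurable_fun (D : set (measurableTypeR R)) (f n).
    exact: measurable_funS (mf n).
  apply: le_trans (le_trans (fatou lebesgue_measure mD mfD (fun n x _ => f0 n x)) _).
    apply: ge0_le_integral => //.
    - exact: measurable_funS (measurable_borel_lip1 gL brho).
    - exact: measurable_fun_limn_einf.
  apply: (@limn_einf_le _ _ _ N) => n nN; apply: le_trans (fI n) _.
  have := costC n; rewrite /path_cost.
  have := NP n nN; have /fineK <- := w_fin (gam n (len n)).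
  rewrite lte_fin; move: (line_integral_ge0 rho0 (gam n) (len n)).
  case: line_integral => [i| |] //= _ an; rewrite -?EFinD ?lee_fin //; lra.
rewrite /path_cost; have /fineK wE := w_fin (gamma l); rewrite -wE.
apply/lee_addgt0Pr => e e0.
have aw : ((fine (w (gamma l)) - e)%:E < w (gamma l))%E.
  by rewrite -[ltRHS]wE lte_fin; lra.
move: (H _ aw); move: (line_integral_ge0 rho0 gamma l).
case: line_integral => [i| |] //= _; rewrite -?EFinD ?lee_fin //; lra.
Qed.

(* Curves issued from near a point where [w] does not vanish can be stopped, at no
   cost, so as to stay in a fixed compact set. *)
Hypothesis local_compact : forall x L, (0 < w x)%E ->
  exists K (r : R), [/\ mcompact dist K, 0 < r & forall gamma l,
    lip1 dist gamma -> 0 <= l <= L -> dist x (gamma 0) < r ->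
    exists l', [/\ 0 <= l', l' <= l, (w (gamma l') <= w (gamma l))%E &
      forall t, 0 <= t <= l' -> K (gamma t)]].

(** If the superlevel set fails to be open at [x], points tending to [x] have cheap curves; a limit
    of these starts at [x] and is too cheap for the value there. *)
Lemma path_inf_lsc : lsc dist (path_inf dist w rho).
Proof.
move=> t x /= tU; apply: contrapT => nU.
have [t0|t0] := ltP t 0.
  apply: nU; exists 1 => // y _ /=.
  by apply: lt_le_trans (path_inf_ge0 dist w0 rho0 y); rewrite lte_fin.
have wx : (0 < w x)%E.
  apply: lt_le_trans (path_inf_le mdist w rho x).
  by apply: le_lt_trans tU; rewrite lee_fin.
have /fineK UE := path_inf_fin mdist w0 w1 rho0 x.
move: tU; rewrite -UE lte_fin; set a := fine _ => ta.
(* One [e] is lost to near-optimality and one to truncation, and [t + 2 * e] is still below [a]. *)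
pose e := (a - t) / 4.
have e0 : 0 < e by rewrite divr_gt0 // subr_gt0.
have te0 : 0 < t + e by lra.
(* Chosen so that the loss [(t + e) / (A * L)] caused by truncating at length [L] is exactly [e]. *)
pose L := (t + e) / (A * e).
have L0 : 0 < L by rewrite divr_gt0 // mulr_gt0.
have [K [r0 [cK r00 Kr]]] := local_compact L wx.
have /choice[gl glP] n : exists gl : (R -> T) * R,
  [/\ lip1 dist gl.1, 0 <= gl.2 <= L, dist x (gl.1 0) < n.+1%:R^-1,
      forall s, K (gl.1 s) & (cost gl.1 gl.2 <= (t + 2 * e)%:E)%E].
  pose r := Num.min r0 n.+1%:R^-1.
  have [y xy Uy] : exists2 y, dist x y < r & (path_inf dist w rho y <= t%:E)%E.
    apply: contrapT => ny; apply: nU; exists r.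
      by rewrite lt_min r00 invr_gt0 ltr0n.
    by move=> y /= xy; rewrite ltNge; apply/negP => ?; apply: ny; exists y.
  have /ereal_inf_lt[_ [gamma [l [gL l0 g0 ->]]] costl] :
      (path_inf dist w rho y < (t + e)%:E)%E.
    by apply: le_lt_trans Uy _; rewrite lte_fin; lra.
  have [l1 [l10 l1l l1L cost1]] := path_cost_truncate gL l0 L0 costl.
  have [||l2 [l20 l21 w21 Kl2]] := Kr gamma l1 gL.
  - by rewrite l10.
  - by rewrite g0 (lt_le_trans xy) // ge_min lexx.
  (* Freezing the curve at time [l2] keeps all its values in [K]. *)
  exists (gamma \o clamp l2, l2); split => /=.
  - exact: lip1_clamp.
  - by rewrite l20 (le_trans l21).
  - by rewrite clamp_id // g0 (lt_le_trans xy) // ge_min lexx orbT.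
  - by move=> s; apply: Kl2; rewrite clamp_ge0 clamp_le.
  - have -> : cost (gamma \o clamp l2) l2 = cost gamma l2.
      rewrite /path_cost /= clamp_id //; congr (_ + _)%E; apply: eq_integral => s.
      by rewrite inE /itv0 /= in_itv /= => /andP[? ?]; rewrite clamp_id.
    apply: (@le_trans _ _ (cost gamma l1)).
      by apply: leeD => //; exact: (le_line_integral rho0 brho gL l21).
    apply: le_trans cost1 _; rewrite lee_fin.
    have -> : (t + e) / (A * L) = e.
      by rewrite /L; field; rewrite !gt_eqF.
    lra.
have [|||gamma [l [gL lL glcv]]] :=
    @lip1_compact _ _ _ _ mdist K (fun n => (gl n).1) (fun n => (gl n).2) L cK.
- by move=> n; have [] := glP n.
- by move=> n; have [] := glP n.
- by move=> n; have [] := glP n.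
have /choice[phi phiP] n : exists m, [/\ (n <= m)%N, `|(gl m).2 - l| < n.+1%:R^-1 &
    forall s, 0 <= s <= L -> dist (gamma s) ((gl m).1 s) < n.+1%:R^-1].
  by apply: glcv; rewrite invr_gt0 ltr0n.
have g0x : gamma 0 = x.
  case: mdist => _ dist_eq0 _ _; apply/dist_eq0/eqP.
  rewrite eq_le dist_ge0 andbT; apply/ler_addgt0Pr => e' e'0.
  have e'2 : 0 < e' / 2 by rewrite divr_gt0.
  have [N _ NP] := near_infty_natSinv_lt (PosNum e'2).
  have [Nm _ /(_ 0)] := phiP N; rewrite lexx ltW // => /(_ isT) h1.
  have [_ _ h2 _ _] := glP (phi N).
  have := NP N (leqnn _); have := NP (phi N) Nm => /= h3 h4.
  have := dist_triangle ((gl (phi N)).1 0) (gamma 0) x.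
  rewrite (distC ((gl (phi N)).1 0) x); move: h1 h2 h3 h4.
  by move: (N.+1%:R^-1) ((phi N).+1%:R^-1) => q q'; lra.
have costC : (cost gamma l <= (t + 2 * e)%:E)%E.
  apply: (@path_cost_lim _ _ (fun n => (gl (phi n)).1) (fun n => (gl (phi n)).2) L) => //.
  - by move=> n; have [] := glP (phi n).
  - by move=> n; have [] := phiP n.
  - by move=> n; have [] := phiP n.
  - by move=> n; have [] := glP (phi n).
have : (path_inf dist w rho x <= (t + 2 * e)%:E)%E.
  apply: le_trans costC; apply: ereal_inf_lbound; exists gamma, l; split => //.
  by case/andP: lL.
rewrite -UE lee_fin -/a /e; lra.
Qed.

End path_infimum_lsc.

(** * Stability of open sets and lower semicontinuous functions *)

Section lsc_operations.
Context {R : realType} {d : measure_display} {T : measurableType d}.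
Variable dist : T -> T -> R.
Implicit Types f g : T -> \bar R.

Lemma mopenI (A B : set T) : mopen dist A -> mopen dist B -> mopen dist (A `&` B).
Proof.
move=> oA oB x [/oA[r r0 rA] /oB[s s0 sB]]; exists (Num.min r s).
  by rewrite lt_min r0 s0.
by move=> y; rewrite /mball /= lt_min => /andP[? ?]; split; [exact: rA|exact: sB].
Qed.

Lemma mopenT : mopen dist setT.
Proof. by move=> x _; exists 1. Qed.

Lemma mopen_bigcup I (F : I -> set T) : (forall i, mopen dist (F i)) ->
  mopen dist (\bigcup_i F i).
Proof.
move=> oF x [i _ /oF[r r0 rF]]; exists r => // y /rF; by exists i.
Qed.

Lemma lsc_scale f (a : R) : 0 < a -> lsc dist f -> lsc dist (fun x => a%:E * f x)%E.
Proof.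
move=> a0 lf t; have := lf (t / a); congr mopen; apply/seteqP; split => x /=;
  by rewrite mulrC EFinM lte_pdivrMl.
Qed.

Lemma lsc_sup (f : nat -> T -> \bar R) : (forall n, lsc dist (f n)) ->
  lsc dist (fun x => ereal_sup (range (f ^~ x))).
Proof.
move=> lf t; have := @mopen_bigcup _ _ (fun n => lf n t); congr mopen.
apply/seteqP; split => x /=.
  move=> [n _ /= tf]; apply: lt_le_trans tf _; apply: ereal_sup_ubound; by exists n.
by move=> /ereal_sup_gt[_ [n _ <-]] tf; exists n.
Qed.

(** The superlevel set is the whole space for [t < 0], empty for [1 <= t], and the part of [{f > t}]
    in [G] in between. *)
Lemma lsc_truncate f (G : set T) : mopen dist G -> (forall x, 0 <= f x)%E -> lsc dist f ->
  lsc dist (fun x => if x \in G then mine (f x) 1%E else 0%E).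
Proof.
move=> oG f0 lf t; have [t0|t0] := ltP t 0.
  have := mopenT; congr mopen; apply/seteqP; split => x //= _.
  have t0E : (t%:E < 0)%E by rewrite lte_fin.
  by case: ifP => // _; rewrite lt_min !(lt_le_trans t0E).
have [t1|t1] := leP 1 t.
  move=> x /=; case: ifP => _; last by rewrite lte_fin ltNge t0.
  by rewrite lt_min [X in _ && X]lte_fin [(t < 1)%R]ltNge t1 andbF.
have := mopenI oG (lf t); congr mopen; apply/seteqP; split => x /=.
  by move=> [/mem_set -> tf]; rewrite lt_min tf lte_fin t1.
case: ifPn => [/set_mem Gx|_]; last by rewrite lte_fin ltNge t0.
by rewrite lt_min => /andP[].
Qed.

End lsc_operations.

(** * Scaling and suprema of upper gradients *)

Section upper_gradient_operations.
Context {R : realType} {d : measure_display} {T : measurableType d}.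
Variable dist : T -> T -> R.
Hypothesis mdist : metric_axioms dist.
Implicit Types f g : T -> \bar R.

(** An arc-length curve is constrained only on [[0, l]]; clamping makes it globally 1-Lipschitz,
    which gives measurable integrands. *)
Lemma line_integral_clamp gamma (l : R) g :
  line_integral gamma l g = line_integral (gamma \o clamp l) l g.
Proof.
apply: eq_integral => t; rewrite inE /itv0 /= in_itv /= => /andP[t0 tl].
by rewrite clamp_id.
Qed.

Lemma le_line_integral_fun gamma (l : R) f g : arc_length_curve dist gamma l ->
  borel_fun dist f -> borel_fun dist g -> (forall x, 0 <= f x)%E ->
  (forall x, f x <= g x)%E ->
  (line_integral gamma l f <= line_integral gamma l g)%E.
Proof.
move=> arc bf bg f0 fg; have gL := arc_length_curve_lip1 mdist arc.
rewrite line_integral_clamp [leRHS]line_integral_clamp.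
apply: ge0_le_integral => //; first exact: measurable_itv.
- exact: measurable_funS (measurable_borel_lip1 gL bf).
- exact: measurable_funS (measurable_borel_lip1 gL bg).
Qed.

Lemma upper_gradient_scale f g (a : R) : 0 < a -> (forall x, f x \is a fin_num) ->
  lsc dist g -> upper_gradient dist f g ->
  upper_gradient dist (fun x => a%:E * f x)%E (fun x => a%:E * g x)%E.
Proof.
move=> a0 ff lg [bg g0 ug]; split.
- exact: lsc_borel (lsc_scale a0 lg).
- by move=> x; rewrite mule_ge0 // lee_fin ltW.
move=> gamma l arc; have gL := arc_length_curve_lip1 mdist arc.
have -> : line_integral gamma l (fun x => a%:E * g x)%E =
    (a%:E * line_integral gamma l g)%E.
  rewrite [LHS]line_integral_clamp [line_integral gamma l g]line_integral_clamp.
  rewrite /line_integral ge0_integralZl_EFin ?ltW //.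
  - exact: measurable_itv.
  - exact: measurable_funS (measurable_borel_lip1 gL bg).
have := ug _ _ arc; rewrite /ug_diff !fin_numM ?ff //=.
have /fineK <- := ff (gamma 0); have /fineK <- := ff (gamma l).
rewrite -!EFinM -!EFinB /= -mulrBr normrM (gtr0_norm a0) EFinM.
by move=> h; rewrite lee_pmul2l // lte_fin.
Qed.

(** Each [f n] varies along a curve by at most the integral of the supremum of the gradients, and
    this passes to the supremum. The common bound [M] keeps that supremum finite, as [ug_diff]
    requires. *)
Lemma upper_gradient_sup (f g : nat -> T -> \bar R) (M : R) :
  (forall n x, 0 <= f n x <= M%:E)%E -> (forall n, lsc dist (g n)) ->
  (forall n, upper_gradient dist (f n) (g n)) ->
  upper_gradient dist (fun x => ereal_sup (range (f ^~ x)))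
    (fun x => ereal_sup (range (g ^~ x))).
Proof.
move=> fM lg ug.
have bG := lsc_borel (lsc_sup lg).
have gG n x : (g n x <= ereal_sup (range (g ^~ x)))%E.
  by apply: ereal_sup_ubound; exists n.
have g0 n x : (0 <= g n x)%E by have [] := ug n.
have F0 x : (0 <= ereal_sup (range (f ^~ x)))%E.
  apply: (@le_trans _ _ (f 0%N x)); first by case/andP: (fM 0%N x).
  by apply: ereal_sup_ubound; exists 0%N.
have FM x : (ereal_sup (range (f ^~ x)) <= M%:E)%E.
  by apply: ge_ereal_sup => _ [n _ <-]; case/andP: (fM n x).
have Ffin x : ereal_sup (range (f ^~ x)) \is a fin_num.
  by rewrite ge0_fin_numE // (le_lt_trans (FM x)) // ltry.
have ffin n x : f n x \is a fin_num.
  by case/andP: (fM n x) => h1 h2; rewrite ge0_fin_numE // (le_lt_trans h2) // ltry.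
split => //.
  by move=> x; apply: le_trans (gG 0%N x).
move=> gamma l arc; rewrite /ug_diff !Ffin /=.
set I := line_integral _ _ _.
have H n : (`|f n (gamma 0%R) - f n (gamma l)| <= I)%E.
  have [bg _ ugn] := ug n.
  have := ugn _ _ arc; rewrite /ug_diff !ffin /= => /le_trans; apply.
  exact: le_line_integral_fun.
have I0 : (0 <= I)%E by apply: integral_ge0 => t _; apply: le_trans (gG 0%N _).
case: I I0 H => [i| |] //= _ H; last by rewrite leey.
have Hle x y : (forall n, f n x <= i%:E + f n y)%E ->
    (ereal_sup (range (f ^~ x)) <= i%:E + ereal_sup (range (f ^~ y)))%E.
  move=> h; apply: ge_ereal_sup => _ [n _ <-]; apply: le_trans (h n) _.
  by apply: leeD => //; apply: ereal_sup_ubound; exists n.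
have h1 : (ereal_sup (range (f ^~ (gamma 0%R))) <=
    i%:E + ereal_sup (range (f ^~ (gamma l))))%E.
  apply: Hle => n; have := H n; have /fineK <- := ffin n (gamma 0%R).
  have /fineK <- := ffin n (gamma l).
  by rewrite /= !lee_fin ler_norml => /andP[? ?]; lra.
have h2 : (ereal_sup (range (f ^~ (gamma l))) <=
    i%:E + ereal_sup (range (f ^~ (gamma 0%R))))%E.
  apply: Hle => n; have := H n; have /fineK <- := ffin n (gamma 0%R).
  have /fineK <- := ffin n (gamma l).
  by rewrite /= !lee_fin ler_norml => /andP[? ?]; lra.
move: h1 h2; have /fineK <- := Ffin (gamma 0%R); have /fineK <- := Ffin (gamma l).
move: (fine _) (fine _) => a b; rewrite -!EFinD !lee_fin => ? ?.
by rewrite ler_norml; apply/andP; split; lra.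
Qed.

End upper_gradient_operations.

(** * Quasinorm estimates and test functions for the capacity *)

Section function_lattice.
Context {R : realType} {d : measure_display} {T : measurableType d}.
Variables (dist : T -> T -> R) (mu : {measure set T -> \bar R}).
Variables (nX : (T -> \bar R) -> \bar R) (c : R).
Hypotheses (mdist : metric_axioms dist) (smu : standing_measure dist mu).
Hypothesis qX : qBFL mu nX c.
Implicit Types (u v f g w rho : T -> \bar R) (E G : set T).

Let measurable_mopen G : mopen dist G -> measurable G.
Proof. by case: smu => h _ _; exact: h. Qed.
Let nX_ge0 u : measurable_fun setT u -> (0 <= nX u)%E.
Proof. by case: qX => _ h _ _ _; exact: h. Qed.
Let c_ge1 : 1 <= c. Proof. by case: qX. Qed.

Lemma nX_le u v : measurable_fun setT u -> measurable_fun setT v ->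
  (forall x, 0 <= u x <= v x)%E -> (nX u <= nX v)%E.
Proof.
case: qX => _ _ _ _ [_ mono _] mu' mv uv; apply: mono => //; apply: aeW => x.
by case/andP: (uv x) => u0 uv'; rewrite !gee0_abs // (le_trans u0).
Qed.

Lemma nX_scale u (a : R) : measurable_fun setT u -> 0 <= a ->
  nX (fun x => a%:E * u x)%E = (a%:E * nX u)%E.
Proof. by case: qX => _ _ _ sc _ mu' a0; rewrite sc // ger0_norm. Qed.

Lemma capX_le E u g : measurable_fun setT u -> upper_gradient dist u g ->
  (nX u + nX g < +oo)%E -> (forall x, E x -> (1 <= u x)%E) ->
  (capX dist nX E <= nX u + nX g)%E.
Proof.
move=> mu' ug fin uE.
have g0 : (0 <= nX g)%E.
  by apply: nX_ge0; apply: borel_measurable measurable_mopen _ _; case: ug.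
have Nu : (N1norm dist nX u <= nX u + nX g)%E.
  by apply: leeD => //; apply: ereal_inf_lbound; exists g.
apply: ge_ereal_inf; exists (N1norm dist nX u) => //; exists u => //; split => //.
split; last exact: le_lt_trans fin.
by split => //; apply: le_lt_trans fin; rewrite leeDl.
Qed.

Lemma capX_lt E (C : \bar R) : (capX dist nX E < C)%E -> exists u g,
  [/\ measurable_fun setT u, upper_gradient dist u g,
      forall x, E x -> (1 <= u x)%E & (nX u + nX g < C)%E].
Proof.
move=> /ereal_inf_lt[_ [u [[[mu' Xu] _] uE] <-]] uC.
have nu_fin : nX u \is a fin_num by rewrite ge0_fin_numE // nX_ge0.
have : (ereal_inf [set nX g | g in upper_gradient dist u] < C - nX u)%E.
  by rewrite lteBrDl.
move=> /ereal_inf_lt[_ [g ug <-]]; rewrite lteBrDl // => gC.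
by exists u, g.
Qed.

(** Gathers what makes a multiple of the path infimum a test function. The norm bound comes from
    [path_inf <= w <= v]; the factor [lam] serves to push values above 1. *)
Lemma path_inf_test_pair w rho v (A lam : R) :
  (forall x, 0 <= w x)%E -> (forall x, w x <= 1)%E -> (forall x, 0 <= rho x)%E ->
  lsc dist w -> lsc dist rho -> 0 < A -> (forall x, A%:E * w x <= rho x)%E ->
  (forall x L, (0 < w x)%E -> exists K (r : R), [/\ mcompact dist K, 0 < r &
    forall gamma l, lip1 dist gamma -> 0 <= l <= L -> dist x (gamma 0) < r ->
    exists l', [/\ 0 <= l', l' <= l, (w (gamma l') <= w (gamma l))%E &
      forall t, 0 <= t <= l' -> K (gamma t)]]) ->
  measurable_fun setT v -> (forall x, w x <= v x)%E -> 0 < lam ->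
  let f x := (lam%:E * path_inf dist w rho x)%E in
  let g x := (lam%:E * rho x)%E in
  [/\ lsc dist f, lsc dist g, forall x, (0 <= f x <= lam%:E)%E,
      upper_gradient dist f g & (nX f <= lam%:E * nX v)%E /\ nX g = (lam%:E * nX rho)%E].
Proof.
move=> w0 w1 rho0 lw lrho A0 Aw cpt mv wv lam0 f g.
have lU := path_inf_lsc mdist w0 w1 rho0 lw lrho A0 Aw cpt.
have brho := lsc_borel lrho.
have mU := lsc_measurable measurable_mopen lU.
have U0 x := path_inf_ge0 dist w0 rho0 x.
split.
- exact: lsc_scale.
- exact: lsc_scale.
- move=> x; apply/andP; split; first by rewrite mule_ge0 // lee_fin ltW.
  rewrite -[leRHS]mule1 lee_pmul2l ?lte_fin //; exact: path_inf_le1.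
- apply: upper_gradient_scale => //; first exact: path_inf_fin.
  exact: path_inf_upper_gradient.
- have lam0' := ltW lam0; rewrite /f /g !nX_scale //; last exact: lsc_measurable lrho.
  split => //; rewrite lee_pmul2l // ?lte_fin //; apply: nX_le => // x.
  by rewrite U0 (le_trans (path_inf_le mdist w rho x)).
Qed.

(** The suprema of the [f n] and of the [g n] form a test pair. Each supremum is at most the
    corresponding sum, whose quasinorm is bounded with weights [c ^+ n.+1]; functions and gradients
    contribute one [e] each. *)
Lemma capX_bigcup_lsc (f g : nat -> T -> \bar R) (M e : R) (G : nat -> set T) :
  (forall n x, 0 <= f n x <= M%:E)%E -> (forall n, lsc dist (f n)) ->
  (forall n, lsc dist (g n)) -> (forall n, upper_gradient dist (f n) (g n)) -> 0 < e ->
  (forall n, (c ^+ n.+1)%:E * (nX (f n) + nX (g n)) <= (e / (2 ^ n.+1)%:R)%:E)%E ->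
  (forall n x, G n x -> (1 <= f n x)%E) ->
  (capX dist nX (\bigcup_n G n) <= (e + e)%:E)%E.
Proof.
move=> fM lf lg ug e0 fge Gf.
have c0 n : 0 <= c ^+ n.+1 by rewrite exprn_ge0 // (le_trans _ c_ge1).
have mf n := lsc_measurable measurable_mopen (lf n).
have mg n := lsc_measurable measurable_mopen (lg n).
have sup_le (h : nat -> T -> \bar R) : (forall n x, 0 <= h n x)%E ->
    (forall n, lsc dist (h n)) -> (forall n, measurable_fun setT (h n)) ->
    (forall n, (c ^+ n.+1)%:E * nX (h n) <= (e / (2 ^ n.+1)%:R)%:E)%E ->
    (nX (fun x => ereal_sup (range (h ^~ x))) <= e%:E)%E.
  move=> h0 lh mh he.
  have : (\sum_(0 <= n <oo) (c ^+ n.+1)%:E * nX (h n) <= e%:E)%E.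
    apply: le_trans (epsilon_trick0 xpredT (ltW e0)); apply: lee_nneseries => //.
    by move=> n _ _; rewrite mule_ge0 // ?lee_fin // nX_ge0.
  apply: le_trans; case: (qX) => _ _ _ _ [_ _ /(_ h mh h0)]; apply: le_trans.
  apply: nX_le.
  - exact: lsc_measurable (lsc_sup lh).
  - exact: ge0_emeasurable_sum.
  move=> x; apply/andP; split.
    by apply: le_trans (h0 0%N x) _; apply: ereal_sup_ubound; exists 0%N.
  apply: ge_ereal_sup => _ [n _ <-].
  rewrite (@nneseriesD1 _ (h ^~ x) n) // leeDl //.
  by apply: nneseries_ge0.
have g0 n x : (0 <= g n x)%E by have [_] := ug n.
have f0 n x : (0 <= f n x)%E by case/andP: (fM n x).
have nf : (nX (fun x => ereal_sup (range (f ^~ x))) <= e%:E)%E.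
  apply: sup_le => // n; apply: le_trans (fge n).
  by rewrite lee_wpmul2l ?lee_fin // leeDl // nX_ge0.
have ng : (nX (fun x => ereal_sup (range (g ^~ x))) <= e%:E)%E.
  apply: sup_le => // n; apply: le_trans (fge n).
  by rewrite lee_wpmul2l ?lee_fin // leeDr // nX_ge0.
apply: (@le_trans _ _ (nX (fun x => ereal_sup (range (f ^~ x))) +
    nX (fun x => ereal_sup (range (g ^~ x))))%E); last by rewrite EFinD leeD.
apply: capX_le.
- exact: lsc_measurable (lsc_sup lf).
- exact: upper_gradient_sup fM lg ug.
- by apply: le_lt_trans (leeD nf ng) _; rewrite -EFinD ltry.
- move=> x [n _ /Gf Gnx]; apply: le_trans Gnx _.
  by apply: ereal_sup_ubound; exists n.
Qed.

Hypothesis vcX : vitali_caratheodory dist nX.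

Lemma vitali_caratheodory_lt u (C : \bar R) : measurable_fun setT u -> (nX u < C)%E ->
  exists v, [/\ lsc dist v, forall x, (`|u x| <= v x)%E & (nX v < C)%E].
Proof.
move=> mu'; rewrite (vcX mu') => /ereal_inf_lt[_ [v [uv lv] <-]] vC.
by exists v.
Qed.

(** The function [h] equal to infinity where [u] is infinite and to 0 elsewhere satisfies
    [2 * h = h]. Its quasinorm is finite since [h <= u], hence zero. *)
Lemma inX_finite u : inX nX u -> (forall x, 0 <= u x)%E ->
  {ae mu, forall x, u x \is a fin_num}.
Proof.
move=> [mu' Xu] u0.
pose h x : \bar R := if u x == +oo%E then +oo%E else 0%E.
have h0 x : (0 <= h x)%E by rewrite /h; case: ifP.
have mh : measurable_fun setT h.
  apply: measurable_fun_superlevel => /= r; have [r0|r0] := ltP r 0.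
    rewrite (_ : [set _ | _] = setT) //; apply/seteqP; split => x //= _.
    by apply: lt_le_trans (h0 x); rewrite lte_fin.
  rewrite (_ : [set _ | _] = u @^-1` [set +oo%E]).
    by rewrite -[X in measurable X]setTI; apply: mu' => //; exact: emeasurable_set1.
  apply/seteqP; split => x /=; rewrite /h.
    by case: eqP => // _; rewrite lte_fin ltNge r0.
  by move=> ->; rewrite eqxx ltry.
have hu : (nX h <= nX u)%E.
  by apply: nX_le => // x; rewrite h0 /h /=; case: ifP => [/eqP ->|_] //.
have h2 : (fun x => 2%:E * h x)%E = h.
  apply/funext => x; rewrite /h; case: ifP => _; last by rewrite mule0.
  by rewrite gt0_muley // lte_fin.
have := nX_scale mh (@ler0n R 2); rewrite h2.
have nh_fin : nX h \is a fin_num.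
  by rewrite ge0_fin_numE ?nX_ge0 // (le_lt_trans hu).
have /fineK E := nh_fin; rewrite -E -EFinM => -[]; set a := fine _ => a2.
have /(_ h mh)[+ _] : forall u, measurable_fun setT u ->
    nX u = 0%E <-> {ae mu, forall x, u x = 0%E} by case: qX.
rewrite -E (_ : fine (nX h) = 0); last by rewrite -/a; lra.
move=> /(_ erefl); apply: filterS => x; rewrite /h ge0_fin_numE // -leye_eq.
by rewrite ltNge; case: ifP.
Qed.

(** The perturbed functions tend to [u] in quasinorm, so continuity applies. Their difference with
    [u] is the multiple of [v] only where [u] is finite, that is, almost everywhere. *)
Lemma nX_perturb u v (C : R) : continuous_qnorm nX -> inX nX u -> inX nX v ->
  (forall x, 0 <= u x)%E -> (forall x, 0 <= v x)%E -> (nX u < C%:E)%E ->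
  exists n : nat, (nX (fun x => u x + n.+1%:R^-1%:E * v x)%E < C%:E)%E.
Proof.
move=> ctX [mu' Xu] [mv Xv] u0 v0 uC.
have ni n : 0 <= n.+1%:R^-1 :> R by rewrite invr_ge0 ler0n.
have mnv n : measurable_fun setT (fun x => n.+1%:R^-1%:E * v x)%E.
  exact: measurable_funeM.
have ms n : measurable_fun setT (fun x => u x + n.+1%:R^-1%:E * v x)%E.
  exact: emeasurable_funD.
have [_ _ _ _ [qadd mono _]] := qX.
have Xs n : inX nX (fun x => u x + n.+1%:R^-1%:E * v x)%E.
  split => //; apply: le_lt_trans (qadd _ _ mu' (mnv n)) _.
  rewrite nX_scale //.
  have nu : nX u \is a fin_num by rewrite ge0_fin_numE // nX_ge0.
  have nv : nX v \is a fin_num by rewrite ge0_fin_numE // nX_ge0.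
  by rewrite ltey_eq fin_numM // fin_numD nu fin_numM.
have nv : nX v \is a fin_num by rewrite ge0_fin_numE // nX_ge0.
have nu : nX u \is a fin_num by rewrite ge0_fin_numE // nX_ge0.
have /ctX : forall n, inX nX (fun x => u x + n.+1%:R^-1%:E * v x)%E by [].
move=> /(_ u (conj mu' Xu)) H.
have {H} : (fun n => nX (fun x => u x + n.+1%:R^-1%:E * v x)%E) @ \oo --> nX u.
  apply: H.
  apply: (@squeeze_cvge _ _ _ _ (cst 0%E) _ (fun n => n.+1%:R^-1%:E * nX v)%E).
  - apply: nearW => n; rewrite nX_ge0 /=; last exact: emeasurable_funB.
    rewrite -nX_scale //; apply: mono => //; first exact: emeasurable_funB.
    have := inX_finite (conj mu' Xu) u0; apply: filterS => x ux.
    by rewrite addeAC subee // add0e.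
  - exact: cvg_cst.
  - rewrite -[X in _ --> X](mul0e (nX v)); apply: cvgeZr => //.
    by apply: cvg_EFin; [exact: nearW|exact: cvg_harmonic].
have /fineK <- := nu; move=> /fine_cvgP[fin cv].
have /cvgr_lt/(_ C) := cv.
have -> : (fine (nX u) < C)%R by rewrite -lte_fin fineK.
move=> /(_ isT) lt; near \oo => n; exists n.
have fn : nX (fun x => u x + n.+1%:R^-1%:E * v x)%E \is a fin_num by near: n.
by rewrite -(fineK fn) lte_fin; near: n.
Unshelve. all: by end_near. Qed.

End function_lattice.

(** * Separability from finite positive measure of balls *)

Section separability.
Context {R : realType} {d : measure_display} {T : measurableType d}.
Variables (dist : T -> T -> R) (mu : {measure set T -> \bar R}).

(** Only finitely many disjoint subsets of [B] have measure at least [k.+1%:R^-1], and every index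
    is counted for some [k]. *)
Lemma countable_trivIset_measure (A B : set T) (F : T -> set T) :
  (forall i, A i -> measurable (F i)) -> measurable B -> (mu B < +oo)%E ->
  (forall i, A i -> F i `<=` B) -> (forall i, A i -> (0 < mu (F i))%E) ->
  trivIset A F -> countable A.
Proof.
move=> mF mB Bfin FB F0 tF.
have muBE : mu B = (fine (mu B))%:E by rewrite fineK // ge0_fin_numE.
pose Ak (k : nat) := [set i | A i /\ (k.+1%:R^-1%:E <= mu (F i))%E].
have AE : A `<=` \bigcup_k Ak k.
  move=> i Ai; have /(_ i Ai) := F0.
  case E : (mu (F i)) => [m| |] //; last by exists 0%N => //; split => //; rewrite E leey.
  rewrite lte_fin => m0; have [N _ NP] := near_infty_natSinv_lt (PosNum m0).
  by exists N => //; split => //; rewrite E lee_fin ltW // NP /=.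
apply: sub_countable (subset_card_le AE) _.
apply: bigcup_countable; first exact: countableP.
move=> k _; apply: finite_set_countable; apply: contrapT => infk.
have [X XA nX] := infinite_set_fset (Num.truncn (fine (mu B) * k.+1%:R)).+1 infk.
have XA' i : i \in X -> Ak k i by move=> ?; exact: XA.
have mX i : i \in X -> measurable (F i) by move=> /XA'[/mF].
have : (mu (\big[setU/set0]_(i <- X) F i) <= mu B)%E.
  apply: le_measure; rewrite ?inE //.
  - by rewrite big_seq; apply: bigsetU_measurable => i iX; exact: mX.
  - rewrite -bigcup_fset => x [i /= iX Fx]; apply: FB Fx; by case: (XA' _ iX).
rewrite measure_fbigsetU //; last first.
  by apply: sub_trivIset tF => i iX; case: (XA' _ iX).
rewrite leNgt => /negP; apply.
apply: (@lt_le_trans _ _ (\sum_(i <- X) k.+1%:R^-1%:E)%E); last first.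
  by rewrite big_seq [leRHS]big_seq; apply: lee_sum => i /XA'[].
rewrite sumEFin big_const_seq count_predT iter_addr_0 muBE lte_fin -[_ *+ size X]mulr_natl.
rewrite ltr_pdivlMr // (lt_le_trans (truncnS_gt _)) // ler_nat.
exact: nX.
Qed.

Hypotheses (mdist : metric_axioms dist) (smu : standing_measure dist mu).

(** A maximal [e]-separated set, given by Zorn's lemma, is an [e]-net. The balls of radius [e / 2]
    about its points are disjoint with positive measure, so each ball about [x0] contains countably
    many of these points. *)
Lemma separable_of_measure (x0 : T) : exists z : nat -> T,
  forall x (e : R), 0 < e -> exists n, dist (z n) x < e.
Proof.
have [dist_ge0 dist_eq0 distC dist_tri] := mdist.
have [mo _ ball_mu] := smu.
have /choice[net netP] (k : nat) : exists N : set T,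
    countable N /\ forall x, exists2 y, N y & dist y x < k.+1%:R^-1.
  pose e : R := k.+1%:R^-1.
  have e0 : 0 < e by rewrite invr_gt0 ltr0n.
  pose sep (A : set T) := forall x y, A x -> A y -> x <> y -> e <= dist x y.
  have [|A [sepA maxA]] := @Zorn_bigcup T sep.
    move=> F Fsep Ftot x y [X FX Xx] [Y FY Yy] xy.
    have [XY|YX] := Ftot _ _ FX FY.
      by apply: Fsep FY _ _ _ Yy xy; exact: XY.
    by apply: Fsep FX _ _ Xx _ xy; exact: YX.
  exists A; split; last first.
    move=> x; apply: contrapT => nx; apply: (maxA (x |` A)).
      split; first by move=> y; right.
      move=> /(_ x (or_introl erefl)) Ax; apply: nx; exists x => //.
      by rewrite (dist_eq0 x x).2.
    have far y : A y -> e <= dist y x.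
      by move=> Ay; rewrite leNgt; apply/negP => ?; apply: nx; exists y.
    move=> y y' [->|Ay] [->|Ay'] // yy'; last exact: sepA.
      by rewrite distC far.
    exact: far.
  have -> : A = \bigcup_m (A `&` mball dist x0 m.+1%:R).
    apply/seteqP; split => x; last by move=> [m _ []].
    move=> Ax; exists (Num.truncn (dist x0 x)) => //; split => //.
    exact: truncnS_gt.
  apply: bigcup_countable; first exact: countableP.
  move=> m _; apply: (@countable_trivIset_measure _ (mball dist x0 (m.+1%:R + e))
      (fun y => mball dist y (e / 2))).
  - by move=> y _; apply/mo/mopen_mball.
  - by apply/mo/mopen_mball.
  - by have /andP[_] := ball_mu x0 (m.+1%:R + e) (addr_gt0 (ltr0Sn _ _) e0).
  - move=> y [_ /= x0y] t /= yt; rewrite /mball /= in x0y yt *.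
    by have := dist_tri x0 y t; lra.
  - move=> y _; have e2 : 0 < e / 2 by rewrite divr_gt0.
    by have /andP[] := ball_mu y _ e2.
  - apply/trivIsetP => y y' [Ay _] [Ay' _] /eqP yy'; apply/seteqP; split => // t [].
    rewrite /mball /= => h1 h2; have := sepA _ _ Ay Ay' yy'.
    by have := dist_tri y t y'; rewrite (distC t y'); lra.
have : countable (\bigcup_k net k).
  by apply: bigcup_countable; [exact: countableP|move=> k _; case: (netP k)].
move=> /countable_injP[f finj].
have /choice[z zP] n : exists x, forall y, (\bigcup_k net k) y -> f y = n -> x = y.
  have [[x [Dx fx]]|nx] := pselect (exists x, (\bigcup_k net k) x /\ f x = n).
    by exists x => y Dy fy; apply: finj; rewrite ?inE // fx fy.
  by exists x0 => y Dy fy; exfalso; apply: nx; exists y.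
exists z => x e e0; have [k _ kP] := near_infty_natSinv_lt (PosNum e0).
have [_ /(_ x)[y ny yx]] := netP k; exists (f y).
rewrite (zP (f y) y) //; last by exists k.
by apply: lt_trans yx _; exact: (kP k (leqnn k)).
Qed.

End separability.

(** * Open supersets of small capacity, and the two conclusions *)

Section capacity.
Context {R : realType} {d : measure_display} {T : measurableType d}.
Variables (dist : T -> T -> R) (mu : {measure set T -> \bar R}).
Variables (nX : (T -> \bar R) -> \bar R) (c : R).
Hypotheses (mdist : metric_axioms dist) (smu : standing_measure dist mu).
Hypotheses (qX : qBFL mu nX c) (vcX : vitali_caratheodory dist nX).
Implicit Types (u v f g w rho : T -> \bar R) (E G K : set T).

Let distC x y : dist x y = dist y x. Proof. by case: mdist. Qed.
Let dist_triangle y x z : dist x z <= dist x y + dist y z.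
Proof. by case: mdist. Qed.
Let measurable_mopen G : mopen dist G -> measurable G.
Proof. by case: smu => h _ _; exact: h. Qed.
Let nX_ge0 u : measurable_fun setT u -> (0 <= nX u)%E.
Proof. by case: qX => _ h _ _ _; exact: h. Qed.

(** If the endpoints differ, [u] drops by at most the integral and [v] dominates its final value; if
    they coincide, [v] is already at least 1 there. An infinite difference forces an infinite
    integral. *)
Lemma upper_gradient_endpoint u g v rho gamma (l : R) :
  upper_gradient dist u g -> (forall x, `|u x| <= v x)%E ->
  borel_fun dist rho -> (forall x, g x <= rho x)%E ->
  lip1 dist gamma -> 0 <= l -> (1 <= u (gamma 0%R))%E ->
  (1 <= v (gamma l) + line_integral gamma l rho)%E.
Proof.
move=> ug uv brho grho gL l0 u1.
have [bg g0 _] := ug.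
have v0 x : (0 <= v x)%E by apply: le_trans (uv x); exact: abse_ge0.
have rho0 x : (0 <= rho x)%E by apply: le_trans (grho x).
have I0 := line_integral_ge0 rho0 gamma l.
have [g0l|g0l] := pselect (gamma 0 = gamma l).
  rewrite -g0l; apply: (@le_trans _ _ (v (gamma 0%R))); last by rewrite leeDl.
  apply: le_trans u1 (le_trans (lee_abs _) (uv _)).
have gI : (line_integral gamma l g <= line_integral gamma l rho)%E.
  apply: ge0_le_integral => //; first exact: measurable_itv.
  - exact: measurable_funS (measurable_borel_lip1 gL bg).
  - exact: measurable_funS (measurable_borel_lip1 gL brho).
have := le_trans (lip1_upper_gradient mdist ug gL l0 g0l) gI.
rewrite /ug_diff; case: ifPn => [/andP[]|_]; last first.
  rewrite leye_eq => /eqP ->; rewrite addey ?leey // gt_eqF //.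
  by apply: lt_le_trans (v0 _); rewrite ltNyr.
move: u1 (uv (gamma l)) (v0 (gamma l)) I0; case: (u (gamma 0%R)) => [a| |] //.
case: (u (gamma l)) => [b| |] //.
case: (v (gamma l)) => [v'| |] //=; case: (line_integral _ _ _) => [i| |] //=;
  rewrite ?leey //.
rewrite !lee_fin => a1 bv v'0 i0 _ _; rewrite ler_norml => /andP[_ ab].
by have := ler_norm b; lra.
Qed.

Lemma lt_fineD (x : \bar R) (e : R) : x \is a fin_num -> 0 < e ->
  (x < (fine x + e)%:E)%E.
Proof. by move=> /fineK xE e0; rewrite -[ltLHS]xE lte_fin ltrDl. Qed.

Lemma capX_mono E G : E `<=` G -> (capX dist nX E <= capX dist nX G)%E.
Proof.
move=> EG; apply: le_ereal_inf => _ [u [Nu uG] <-]; exists u => //; split => //.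
by move=> x /EG/uG.
Qed.

Lemma capX_open_superset u g E (e : R) : metric_proper dist -> continuous_qnorm nX ->
  measurable_fun setT u -> upper_gradient dist u g -> (nX u + nX g < +oo)%E ->
  (forall x, E x -> (1 <= u x)%E) -> 0 < e ->
  exists G, [/\ mopen dist G, E `<=` G & (capX dist nX G <= nX u + nX g + e%:E)%E].
Proof.
move=> proper ctX mu' ug fin uE e0.
have [bg g0 _] := ug; have mg := borel_measurable measurable_mopen bg.
have nu0 := nX_ge0 mu'; have ng0 := nX_ge0 mg.
have nu : nX u \is a fin_num.
  by rewrite ge0_fin_numE // (le_lt_trans _ fin) // leeDl.
have ng : nX g \is a fin_num.
  by rewrite ge0_fin_numE // (le_lt_trans _ fin) // leeDr.
have e4 : 0 < e / 4 by rewrite divr_gt0.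
have [v [lv uv vC]] := vitali_caratheodory_lt vcX mu' (lt_fineD nu e4).
have mv := lsc_measurable measurable_mopen lv.
have v0 x : (0 <= v x)%E by apply: le_trans (uv x); exact: abse_ge0.
have Xv : inX nX v by split => //; apply: lt_trans vC (ltry _).
have Xg : inX nX g by split => //; rewrite -ge0_fin_numE.
have [n gvC] := nX_perturb qX ctX Xg Xv g0 v0 (lt_fineD ng e4).
have n0 : 0 < n.+1%:R^-1 :> R by rewrite invr_gt0 ltr0n.
have nv0 x : (0 <= n.+1%:R^-1%:E * v x)%E by rewrite mule_ge0 // lee_fin ltW.
have mgv : measurable_fun setT (fun x => g x + n.+1%:R^-1%:E * v x)%E.
  by apply: emeasurable_funD => //; exact: measurable_funeM.
have [rho [lrho gvrho rhoC]] := vitali_caratheodory_lt vcX mgv gvC.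
have gvrho' x : (g x + n.+1%:R^-1%:E * v x <= rho x)%E.
  exact: le_trans (lee_abs _) (gvrho x).
have grho x : (g x <= rho x)%E by apply: le_trans (gvrho' x); rewrite leeDl.
have vrho x : (n.+1%:R^-1%:E * v x <= rho x)%E.
  by apply: le_trans (gvrho' x); rewrite leeDr.
have rho0 x : (0 <= rho x)%E := le_trans (g0 x) (grho x).
pose w x := if x \in [set: T] then mine (v x) 1%E else 0%E.
have wE x : w x = mine (v x) 1%E by rewrite /w in_setT.
have lw : lsc dist w by apply: lsc_truncate => //; exact: mopenT.
have wv x : (w x <= v x)%E by rewrite wE ge_min lexx.
have w0 x : (0 <= w x)%E by rewrite wE le_min v0 /=.
have w1 x : (w x <= 1)%E by rewrite wE ge_min lexx orbT.
have Aw x : (n.+1%:R^-1%:E * w x <= rho x)%E.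
  by apply: le_trans (vrho x); rewrite lee_wpmul2l // lee_fin ltW.
(* This bounds [nX v + nX rho], and [lam] is chosen so that [lam * s = s + e / 2], the allowed
   total. As [lam > 1], the path infimum being at least 1 on [E] puts [E] in the open set
   [{f > 1}]. *)
pose s := fine (nX u) + fine (nX g) + e / 2.
have s0 : 0 < s by rewrite ltr_wpDl ?divr_gt0 // addr_ge0 ?fine_ge0.
pose lam := (s + e / 2) / s.
have lam1 : 1 < lam by rewrite ltr_pdivlMr // mul1r ltrDl divr_gt0.
have lam0 : 0 < lam by apply: lt_trans lam1.
have [|lf lrho' f0 ugf [nf nrho]] := path_inf_test_pair mdist smu qX w0 w1 rho0 lw lrho n0 Aw _ mv wv lam0.
  (* A curve starting within 1 of [x] and of length at most [L] stays in this closed ball, compact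
     by properness. *)
  move=> x L _; exists (mcball dist x (`|L| + 1)), 1; split => //.
    by apply: proper; rewrite ltr_wpDl.
  move=> gamma l gL /andP[l0 lL] xg; exists l; split => // t /andP[t0 tl].
  rewrite /mcball /=; have := dist_triangle (gamma 0) x (gamma t).
  have := gL 0 t; rewrite sub0r normrN (ger0_norm t0).
  by have := ler_norm L; lra.
set f := (fun x => (lam%:E * path_inf dist w rho x)%E) in lf f0 ugf nf.
set h := (fun x => (lam%:E * rho x)%E) in lrho' ugf nrho.
have fhC : (nX f + nX h <= nX u + nX g + e%:E)%E.
  rewrite nrho; apply: (le_trans (leeD nf (lexx _))).
  rewrite -ge0_muleDr ?nX_ge0 //; last exact: lsc_measurable lrho.
  apply: (@le_trans _ _ (lam%:E * s%:E)%E).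
    apply: lee_wpmul2l; first by rewrite lee_fin ltW.
    apply/ltW/(@lt_le_trans _ _ ((fine (nX u) + e / 4)%:E + (fine (nX g) + e / 4)%:E)%E).
      exact: lteD.
    by rewrite -EFinD lee_fin /s; lra.
  rewrite -(fineK nu) -(fineK ng) -EFinM -!EFinD lee_fin /lam divfK ?gt_eqF //=.
  by rewrite /s; lra.
exists [set x | (1 < f x)%E]; split.
- exact: lf.
- move=> x Ex; rewrite /= /f.
  apply: (@lt_le_trans _ _ (lam%:E * 1)%E); first by rewrite mule1 lte_fin.
  apply: lee_wpmul2l; first by rewrite lee_fin ltW.
  apply: le_ereal_inf_tmp => _ [gamma [l [gL l0 g0x ->]]].
  rewrite /path_cost wE minEle; case: ifP => _.
    by apply: upper_gradient_endpoint ug uv _ grho gL l0 _; rewrite ?g0x ?uE //; exact: lsc_borel.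
  by rewrite leeDl // line_integral_ge0.
- apply: (le_trans _ fhC); apply: (capX_le smu qX) => //.
  + exact: lsc_measurable lf.
  + apply: le_lt_trans fhC _.
    by rewrite -(fineK nu) -(fineK ng) -!EFinD ltry.
  + by move=> x /ltW.
Qed.

Lemma proper_outer_capacity : metric_proper dist -> continuous_qnorm nX ->
  outer_capacity dist nX.
Proof.
move=> proper ctX E; apply/eqP; rewrite eq_le; apply/andP; split.
  by apply: le_ereal_inf_tmp => _ [G [_ EG] <-]; exact: capX_mono.
rewrite leNgt; apply/negP => /(capX_lt qX)[u [g [mu' ug uE]]].
rewrite ltNge => /negP; apply.
have [fin|] := ltP (nX u + nX g)%E +oo%E; last first.
  by rewrite leye_eq => /eqP ->; rewrite leey.
apply/lee_addgt0Pr => e e0.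
have [G [oG EG capG]] := capX_open_superset proper ctX mu' ug fin uE e0.
by apply: le_trans capG; apply: ereal_inf_lbound; exists G.
Qed.

(* A curve from [B(z, r)] to the complement of [B(z, 2r)] has length at least [r], so
   either the term [r^-1 * v] makes it expensive or it meets a point where [v < 1/2]. *)
Lemma local_path_inf_ge u g v rho w (z : T) (r : R) (x : T) : 0 < r ->
  upper_gradient dist u g -> (forall x, `|u x| <= v x)%E -> lsc dist rho ->
  (forall x, g x <= rho x)%E -> (forall x, r^-1%:E * v x <= rho x)%E ->
  (forall y, w y = if y \in mball dist z (2 * r) then mine (v y) 1%E else 0%E) ->
  (1 <= u x)%E -> dist z x < r ->
  (2^-1%:E <= path_inf dist w rho x)%E.
Proof.
move=> r0 ug uv lrho grho vrho wE u1 zx.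
have [bg g0 _] := ug.
have brho := lsc_borel lrho.
have v0 y : (0 <= v y)%E by apply: le_trans (uv y); exact: abse_ge0.
have rho0 y : (0 <= rho y)%E := le_trans (g0 y) (grho y).
have w0 y : (0 <= w y)%E by rewrite wE; case: ifP => // _; rewrite le_min v0 /=.
apply: le_ereal_inf_tmp => _ [gamma [l [gL l0 g0x ->]]].
rewrite leNgt; apply/negP => cost2.
have I2 : (line_integral gamma l rho < 2^-1%:E)%E.
  by apply: le_lt_trans cost2; rewrite /path_cost leeDr.
have vbig s : 0 <= s <= l -> (2^-1%:E <= v (gamma s))%E.
  move=> /andP[s0 sl].
  have := upper_gradient_endpoint ug uv brho grho gL s0; rewrite g0x => /(_ u1).
  have := le_lt_trans (le_line_integral rho0 brho gL sl) I2.
  have := line_integral_ge0 rho0 gamma s; have := v0 (gamma s).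
  case: (v (gamma s)) => [a| |] //=; rewrite ?leey //.
  case: (line_integral _ _ _) => [i| |] //=.
  by rewrite -EFinD !lee_fin lte_fin => *; lra.
move: cost2; rewrite /path_cost wE; case: ifPn => [_|/negP zl].
  apply/negP; rewrite -leNgt; apply: (@le_trans _ _ (mine (v (gamma l)) 1%E)).
    by rewrite le_min vbig ?l0 ?lexx //= lee_fin; lra.
  by rewrite leeDl // line_integral_ge0.
have rl : r <= l.
  rewrite leNgt; apply/negP => lr; apply: zl; rewrite inE; rewrite /mball /=.
  have := dist_triangle (gamma 0) z (gamma l); rewrite g0x.
  by have := gL 0 l; rewrite g0x sub0r normrN (ger0_norm l0); lra.
move=> _; move: I2; apply/negP; rewrite -leNgt.
apply: le_trans (le_line_integral rho0 brho gL rl).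
have -> : 2^-1%:E = (\int[lebesgue_measure]_(x in itv0 r) (2^-1 / r)%:E)%E.
  rewrite integral_cst /=; last exact: measurable_itv.
  rewrite /itv0 lebesgue_measure_itv /= lte_fin r0 oppr0 adde0 -EFinM.
  by rewrite divfK // gt_eqF.
apply: ge0_le_integral => //.
- exact: measurable_itv.
- by move=> y _; rewrite lee_fin divr_ge0 // ?invr_ge0 // ltW.
- by apply: measurable_funS (measurable_borel_lip1 gL brho).
- move=> t; rewrite /itv0 /= in_itv /= => /andP[t0 tr].
  apply: le_trans (vrho _); rewrite mulrC EFinM.
  apply: lee_wpmul2l; first by rewrite lee_fin invr_ge0 ltW.
  by apply: vbig; rewrite t0 (le_trans tr).
Qed.

(** If the curve leaves [B(z, 2r)], it is stopped at an exterior time less than [r] after the first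
    exit, where [w] vanishes. At each earlier time the curve is within [r] of a point of [B(z, 2r)],
    hence in [B(z, 4r)]. *)
Lemma lip1_truncate_ball K (z : T) (r : R) w (x : T) (gamma : R -> T) (l : R) :
  mball dist z (4 * r) `<=` K -> 0 < r ->
  (forall y, 0 <= w y)%E -> (forall y, 2 * r <= dist z y -> w y = 0%E) ->
  lip1 dist gamma -> 0 <= l -> dist x (gamma 0) < 2 * r - dist z x ->
  exists l', [/\ 0 <= l', l' <= l, (w (gamma l') <= w (gamma l))%E &
      forall t, 0 <= t <= l' -> K (gamma t)].
Proof.
move=> zK r0 w0 wz gL l0 xg.
pose S := [set t : R | 0 <= t <= l /\ 2 * r <= dist z (gamma t)].
have start : dist z (gamma 0) < 2 * r.
  by have := dist_triangle x z (gamma 0); lra.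
have [[t0 St0]|nS] := pselect (S !=set0); last first.
  exists l; split => // t tl; apply: zK; rewrite /mball /=.
  suff : dist z (gamma t) < 2 * r by lra.
  by rewrite ltNge; apply/negP => h; apply: nS; exists t.
have hS : has_inf S by split; [exists t0|exists 0 => t [/andP[]]].
have [t [/andP[t0' tl] zt] tS] := inf_adherent r0 hS.
exists t; split => //; first by rewrite wz.
move=> s /andP[s0 st]; apply: zK; rewrite /mball /=.
have near s' : 0 <= s' -> s' <= s -> s - s' <= r -> ~ S s' -> dist z (gamma s) < 4 * r.
  move=> s'0 s's ss' nS; have zs' : dist z (gamma s') < 2 * r.
    rewrite ltNge; apply/negP => h; apply: nS; split => //.
    by rewrite s'0 (le_trans s's) // (le_trans st).
  have := dist_triangle (gamma s') z (gamma s); have := gL s' s.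
  by rewrite distrC ger0_norm ?subr_ge0 //; lra.
have [sr|rs] := leP s r.
  apply: (near 0) => //; first by rewrite subr0.
  by move=> [_]; rewrite leNgt start.
apply: (near (s - r)).
- by rewrite subr_ge0 ltW.
- by rewrite lerBlDr lerDl ltW.
- by rewrite subKr.
- by move=> /(ge_inf hS.2); lra.
Qed.

Lemma capX_local K (z : T) (r e : R) : mcompact dist K -> 0 < r ->
  mball dist z (4 * r) `<=` K -> 0 < e ->
  exists2 eta : R, 0 < eta & forall E, (capX dist nX E < eta%:E)%E ->
  exists f g, [/\ forall x, (0 <= f x <= 3%:E)%E, lsc dist f, lsc dist g,
    upper_gradient dist f g & (nX f + nX g <= e%:E)%E /\
    forall x, E x -> dist z x < r -> (1 < f x)%E].
Proof.
move=> cK r0 zK e0.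
have c1 : 1 <= c by case: qX.
have c0 : 0 < c := lt_le_trans ltr01 c1.
have r'0 : 0 < r^-1 by rewrite invr_gt0.
(* The quasi-triangle inequality bounds [nX] of [g + r^-1 * v] by [M * eta]; scaling by 3 gives the
   total [3 * eta + 3 * (M * eta) = e]. The factor 3 lifts the lower bound [1/2] of the path infimum
   above 1. *)
pose M := c * (1 + r^-1).
have M0 : 0 < M by rewrite mulr_gt0 // addr_gt0.
pose eta := e / (3 * (1 + M)).
have eta0 : 0 < eta by rewrite divr_gt0 // mulr_gt0 // addr_gt0.
exists eta => // E /(capX_lt qX)[u [g [mu' ug uE ugC]]].
have [bg g0 _] := ug; have mg := borel_measurable measurable_mopen bg.
have nu0 := nX_ge0 mu'; have ng0 := nX_ge0 mg.
have uC : (nX u < eta%:E)%E by apply: le_lt_trans ugC; rewrite leeDl.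
have gC : (nX g < eta%:E)%E by apply: le_lt_trans ugC; rewrite leeDr.
have [v [lv uv vC]] := vitali_caratheodory_lt vcX mu' uC.
have mv := lsc_measurable measurable_mopen lv.
have nv0 := nX_ge0 mv.
have v0 x : (0 <= v x)%E by apply: le_trans (uv x); exact: abse_ge0.
have rv0 x : (0 <= r^-1%:E * v x)%E by rewrite mule_ge0 // lee_fin ltW.
have mrv : measurable_fun setT (fun x => r^-1%:E * v x)%E by exact: measurable_funeM.
have mgv : measurable_fun setT (fun x => g x + r^-1%:E * v x)%E.
  exact: emeasurable_funD.
have gvC : (nX (fun x => g x + r^-1%:E * v x)%E < (M * eta)%:E)%E.
  case: (qX) => _ _ _ _ [/(_ _ _ mg mrv) + _ _] => /le_lt_trans; apply.
  rewrite (nX_scale qX mv (ltW r'0)).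
  move: ng0 nv0 gC vC; case: (nX g) => [a| |] //; case: (nX v) => [b| |] //.
  rewrite -(EFinM r^-1) -EFinD -EFinM !lte_fin => _ _ ga vb.
  rewrite /M -mulrA ltr_pM2l // mulrDl mul1r ltrD // ltr_pM2l //.
have [rho [lrho gvrho rhoC]] := vitali_caratheodory_lt vcX mgv gvC.
have gvrho' x : (g x + r^-1%:E * v x <= rho x)%E.
  exact: le_trans (lee_abs _) (gvrho x).
have grho x : (g x <= rho x)%E by apply: le_trans (gvrho' x); rewrite leeDl.
have vrho x : (r^-1%:E * v x <= rho x)%E.
  by apply: le_trans (gvrho' x); rewrite leeDr.
have rho0 x : (0 <= rho x)%E := le_trans (g0 x) (grho x).
pose w x := if x \in mball dist z (2 * r) then mine (v x) 1%E else 0%E.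
have lw : lsc dist w by apply: lsc_truncate => //; exact: mopen_mball.
have wv x : (w x <= v x)%E by rewrite /w; case: ifP => // _; rewrite ge_min lexx.
have w0 x : (0 <= w x)%E by rewrite /w; case: ifP => // _; rewrite le_min v0 /=.
have w1 x : (w x <= 1)%E by rewrite /w; case: ifP => // _; rewrite ge_min lexx orbT.
have Aw x : (r^-1%:E * w x <= rho x)%E.
  by apply: le_trans (vrho x); rewrite lee_wpmul2l // lee_fin ltW.
have wz y : 2 * r <= dist z y -> w y = 0%E.
  by rewrite /w; case: ifPn => // /set_mem; rewrite /mball /= => /lt_le_trans h1 /h1; rewrite ltxx.
have l30 : (0 : R) < 3 by [].
have [|lf lh f0 ugf [nf nh]] := path_inf_test_pair mdist smu qX w0 w1 rho0 lw lrho r'0 Aw _ mv wv l30.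
  move=> x L wx; exists K, (2 * r - dist z x); split => //.
    rewrite subr_gt0 ltNge; apply/negP => /wz wx0.
    by move: wx; rewrite wx0 ltxx.
  move=> gamma l gL /andP[l0 _] xg; exact: lip1_truncate_ball zK r0 w0 wz gL l0 xg.
exists (fun x => 3%:E * path_inf dist w rho x)%E, (fun x => 3%:E * rho x)%E.
split => //; split.
  rewrite nh; apply: le_trans (leeD nf (lexx _)) _.
  have mrho := nX_ge0 (lsc_measurable measurable_mopen lrho).
  move: nv0 mrho vC rhoC; case: (nX v) => [a| |] //; case: (nX rho) => [b| |] //.
  rewrite -!EFinM -EFinD !lte_fin !lee_fin => _ _ ha hb.
  have : e = 3 * eta + 3 * (M * eta).
    by rewrite /eta; field; apply: lt0r_neq0; rewrite addrC ltr_wpDl // ltW.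
  by move=> ->; lra.
move=> x Ex zx.
have := local_path_inf_ge r0 ug uv lrho grho vrho (fun _ => erefl) (uE x Ex) zx.
rewrite -/w => /(lee_wpmul2l (_ : (0 <= 3%:E :> \bar R)%E)) h.
apply: lt_le_trans (h _) => //; by rewrite -EFinM lte_fin; lra.
Qed.

Lemma locally_compact_quasicontinuous u : metric_locally_compact dist ->
  weakly_quasicontinuous dist nX u -> quasicontinuous dist nX u.
Proof.
move=> lc wqc e e0.
(* In an empty space any exceptional set is open. *)
have [[x0 _]|nT] := pselect (exists x : T, True); last first.
  have [E [capE uE]] := wqc e e0; exists E; split => // x.
  by exfalso; apply: nT; exists x.
have [z zP] := separable_of_measure mdist smu x0.
pose rad (p : nat * nat) : R := p.2.+1%:R^-1.
pose good (p : nat * nat) := exists K, mcompact dist K /\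
  mball dist (z p.1) (4 * rad p) `<=` K.
have cover x : exists p, good p /\ dist (z p.1) x < rad p.
  have [K [cK [r r0 rK]]] := lc x.
  (* With centre and radius both off by less than [q < r / 5], the ball of radius [4q] about [z n]
     lies within [5q] of [x]. *)
  have r5 : 0 < r / 5 by rewrite divr_gt0.
  have [k _ /(_ k (leqnn k)) /= kr] := near_infty_natSinv_lt (PosNum r5).
  have k0 : 0 < k.+1%:R^-1 :> R by rewrite invr_gt0.
  have [n nx] := zP x _ k0; exists (n, k); split => //.
  exists K; split => // y; rewrite /mball /rad /= => ny; apply: rK; rewrite /mball /=.
  have := dist_triangle (z n) x y; rewrite (distC x (z n)); move: nx ny kr.
  by move: (k.+1%:R^-1) => q; lra.
have [p0 [good0 _]] := cover x0.
(* Enumeration of the good pairs by their codes, with [p0] as value at the other integers. *)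
have /choice[idx idxP] (n : nat) : exists q, good q /\ forall p, good p -> choice.pickle p = n -> q = p.
  have [[p [gp pn]]|np] := pselect (exists p, good p /\ choice.pickle p = n).
    exists p; split => // p' _ p'n; apply: (pcan_inj choice.pickleK); congruence.
  by exists p0; split => // p gp pn; exfalso; apply: np; exists p.
have c0 : 0 < c by apply: lt_le_trans ltr01 _; case: qX.
(* Division by [c ^+ n.+1] offsets the weights of the countable quasi-triangle inequality, the
   powers of 2 make the series sum to [e / 3], and functions and gradients together stay below
   [e]. *)
pose del n : R := e / 3 / (2 ^ n.+1)%:R / c ^+ n.+1.
have cn0 n : 0 < c ^+ n.+1 by rewrite exprn_gt0.
have del0 n : 0 < del n by rewrite !divr_gt0 // ltr0n expn_gt0.
have /choice[F FP] n : exists F : (T -> \bar R) * (T -> \bar R) * set T,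
    [/\ forall x, (0 <= F.1.1 x <= 3%:E)%E, lsc dist F.1.1 /\ lsc dist F.1.2,
      upper_gradient dist F.1.1 F.1.2, (nX F.1.1 + nX F.1.2 <= (del n)%:E)%E &
      cont_off dist u F.2 /\ forall x, F.2 x -> dist (z (idx n).1) x < rad (idx n) ->
      (1 < F.1.1 x)%E].
  have [[K [cK zK]] _] := idxP n.
  have rad0 : 0 < rad (idx n) by rewrite invr_gt0.
  have [eta eta0 etaP] := capX_local cK rad0 zK (del0 n).
  have [E [capE uE]] := wqc _ eta0.
  have [f [g [f3 lf lg ugf [fg fE]]]] := etaP _ capE.
  by exists (f, g, E).
exists (\bigcup_n [set x | (1 < (F n).1.1 x)%E]); split.
- by apply: mopen_bigcup => n; have [_ [lf _] _ _ _] := FP n; exact: lf.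
- apply: (@le_lt_trans _ _ (e / 3 + e / 3)%:E); last by rewrite lte_fin; lra.
  apply: (capX_bigcup_lsc mdist smu qX (f := fun n => (F n).1.1)
    (g := fun n => (F n).1.2) (M := 3)).
  + by move=> n; have [] := FP n.
  + by move=> n; have [_ []] := FP n.
  + by move=> n; have [_ []] := FP n.
  + by move=> n; have [] := FP n.
  + by rewrite divr_gt0.
  + move=> n; have [_ _ _ fg _] := FP n.
    apply: (@le_trans _ _ ((c ^+ n.+1)%:E * (del n)%:E)%E).
      apply: lee_wpmul2l; [by rewrite lee_fin ltW | exact: fg].
    by rewrite -EFinM lee_fin /del mulrC divfK // gt_eqF.
  + by move=> n x /ltW.
have off n x : dist (z (idx n).1) x < rad (idx n) ->
    ~ (\bigcup_n [set x | (1 < (F n).1.1 x)%E]) x -> ~ (F n).2 x.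
  move=> zx nG Ex; apply: nG; exists n => //=.
  by have [_ _ _ _ [_]] := FP n; exact.
have near x : exists n, dist (z (idx n).1) x < rad (idx n).
  have [p [gp px]] := cover x; exists (choice.pickle p).
  by have [_ /(_ p gp erefl) ->] := idxP (choice.pickle p).
split=> [x nGx|x nGx eps eps0]; have [n nx] := near x; have nEx := off n x nx nGx;
  have [_ _ _ _ [[ufin ucont] _]] := FP n; first exact: ufin.
have [de de0 deP] := ucont x nEx eps eps0.
(* The second bound keeps [y] in the same ball as [x], where avoiding the open union implies
   avoiding the exceptional set of index [n]. *)
exists (Num.min de (rad (idx n) - dist (z (idx n).1) x)).
  by rewrite lt_min de0 subr_gt0.
move=> y nGy; rewrite lt_min => /andP[xy1 xy2]; apply: deP => //; apply: off nGy.
by have := dist_triangle x (z (idx n).1) y; lra.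
Qed.

End capacity.

Theorem theorem1p5 (R : realType) (d : measure_display) (T : measurableType d)
    (dist : T -> T -> R) (mu : {measure set T -> \bar R})
    (nX : (T -> \bar R) -> \bar R) (c : R) :
  metric_axioms dist -> standing_measure dist mu ->
  qBFL mu nX c -> continuous_qnorm nX ->
  vitali_caratheodory dist nX ->
  (metric_proper dist -> outer_capacity dist nX) /\
  (metric_locally_compact dist ->
     forall u : T -> \bar R,
       weakly_quasicontinuous dist nX u -> quasicontinuous dist nX u).
Proof.
move=> mdist smu qX ctX vcX; split=> [proper|lc u].
- exact: (proper_outer_capacity mdist smu qX vcX proper ctX).
- exact: (locally_compact_quasicontinuous mdist smu qX vcX lc).
Qed.
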